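(* Let $\alpha\in(\pi,3\pi/2)$ and let $\nu$ be a positive locally finite measure on $\mathbb R$ such that $$\lim_{x\to\infty}\frac{\nu(x)}{x}=\lim_{x\to-\infty}\frac{\nu(x)}{x}=\frac{\gamma(F)}{2}\sqrt{\tan\alpha}.$$ Then, with probability one, $$\lim_{t\to\infty}\frac{X_\nu(t)}{t}=\frac{1}{\tan\alpha}.$$
   Context: Let $\mathbf P\subset\mathbb R^2$ be a homogeneous Poisson process of intensity one with i.i.d. positive weights of distribution $F$, independent of $\mathbf P$, where $\int_0^\infty e^{ax}dF(x)<\infty$ for some $a>0$. $L(\mathbf p,\mathbf q)$ is the maximal total weight of a coordinatewise increasing finite sequence of points of $\mathbf P$ in $\{\mathbf x:p_1<x_1\le q_1,\ p_2<x_2\le q_2\}$; $\gamma(F)=\sup_{n\ge1}\mathbb{E}L(\mathbf 0,(n,n))/n$. For a positive locally finite measure $\nu$, $\nu(x)=\nu((0,x])$ for $x\ge0$ and $\nu(x)=-\nu((x,0])$ for $x<0$. The fluid process: $L_\nu(x,t)=\sup_{z\le x}\{\nu(z)+L((z,0),(x,t))\}$ for $t\ge0$ and $M^t_\nu((x,y])=L_\nu(y,t)-L_\nu(x,t)$. Second-class particle: fix $\varepsilon>0$, let $\bar\nu=\nu+\varepsilon\delta_0$, run $M^t_{\bar\nu}$ with the same weighted Poisson points, and set $X_\nu(t)=\inf\{x\ge0: M^t_{\bar\nu}([0,x])=M^t_\nu([0,x])+\varepsilon\}$ (this does not depend on $\varepsilon$). *)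

(* Defs.v *)
From HB Require Import structures.
From mathcomp Require Import all_boot all_order all_algebra.
From mathcomp Require Import all_classical all_reals all_analysis.
Import Order.TTheory GRing.Theory Num.Theory.
Import numFieldNormedType.Exports.
Set Implicit Arguments.
Unset Strict Implicit.
Unset Printing Implicit Defensive.
Local Open Scope classical_set_scope.
Local Open Scope ring_scope.

Section Defs.
Variable R : realType.

(* A marked point: ((x1, x2), weight). *)
Definition Pt := ((R * R) * R)%type.

(* Intensity of the weighted Poisson process viewed as a Poisson process on
   R^2 x R: (Lebesgue on R^2) x F. *)
Definition intensity (F : set R -> \bar R) : set Pt -> \bar R :=
  ((@lebesgue_measure R \x @lebesgue_measure R) \x F)%E.

Definition poisson_prob (m : R) (k : nat) : R :=
  m ^+ k / (k`!)%:R * expR (- m).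

Definition is_poisson_process d (Omega : measurableType d)
    (P : probability Omega R) (Pi : Omega -> set Pt) (mu : set Pt -> \bar R) :=
  forall (n : nat) (A : 'I_n -> set Pt) (k : 'I_n -> nat),
    (forall i, measurable (A i)) ->
    (forall i, (mu (A i) < +oo)%E) ->
    (forall i j, i != j -> A i `&` A j = set0) ->
    let E := \bigcap_(i in setT) [set w | @counting _ R (Pi w `&` A i) = ((k i)%:R)%:E] in
    measurable E /\ P E = (\prod_(i < n) poisson_prob (fine (mu (A i))) (k i))%:E.

Definition in_rect (p q : R * R) (z : Pt) : Prop :=
  p.1 < z.1.1 <= q.1 /\ p.2 < z.1.2 <= q.2.

Definition lt_pt (z w : Pt) : bool := (z.1.1 < w.1.1) && (z.1.2 < w.1.2).

Definition LPP (C : set Pt) (p q : R * R) : R :=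
  sup [set \sum_(z <- s) z.2 | s in
        [set s : seq Pt | sorted lt_pt s /\ (forall z, z \in s -> C z /\ in_rect p q z)]].

Definition gammaF d (Omega : measurableType d) (P : probability Omega R)
    (Pi : Omega -> set Pt) : \bar R :=
  ereal_sup [set ((\int[P]_w (LPP (Pi w) (0, 0) (n%:R, n%:R))%:E) * (n%:R^-1)%:E)%E
              | n in [set n : nat | (0 < n)%N]].

Definition dist_fn (mu : set R -> \bar R) (x : R) : R :=
  if 0 <= x then fine (mu `]0, x]%classic) else - fine (mu `]x, 0]%classic).

Definition Lfluid (V : R -> R) (C : set Pt) (x t : R) : R :=
  sup [set V z + LPP C (z, 0) (x, t) | z in `]-oo, x]%classic].

(* M^t_nu([0,x]) = inf_{y<0} M^t_nu((y,x]) = inf_{y<0} (L_nu(x,t) - L_nu(y,t)) *)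
Definition Mclosed (V : R -> R) (C : set Pt) (t x : R) : R :=
  inf [set Lfluid V C x t - Lfluid V C y t | y in `]-oo, 0[%classic].

Definition add_atom0 (mu : set R -> \bar R) (eps : R) : set R -> \bar R :=
  fun A => (mu A + eps%:E * @dirac _ R (0 : R)%R R A)%E.

Definition Xsecond (mu : set R -> \bar R) (eps : R) (C : set Pt) (t : R) : R :=
  inf [set x | 0 <= x /\
        Mclosed (dist_fn (add_atom0 mu eps)) C t x = Mclosed (dist_fn mu) C t x + eps].

Definition locally_finite (mu : set R -> \bar R) :=
  forall a b : R, (mu `]a, b]%classic < +oo)%E.

End Defs.

(* Main.v *)
(* L(p, q) is approximated from below by the best chain of occupied cells of an
   N x N x N^2 grid (space and weight levels). The law of the occupied cells is
   determined by void probabilities, so L is measurable, its law depends only on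
   the area of the box, and consecutive boxes are independent. A first moment
   bound over chains of cells, using the exponential moment of F, gives
   P(L > y) <= exp(2 sqrt(m area) - a y).

   For a large constant C, the truncated defect W_r = max(C r - L_r, 0) of a box
   of area r^2 is nonnegative, bounded and subadditive, hence
   E W_{2r}^2 <= 2 E W_r^2 + 2 (E W_r)^2; the variances of W_{2^k r} / 2^k are
   therefore summable in k, and L(2^k p, 2^k q) / 2^k converges almost surely to
   gamma sqrt(area) simultaneously for all rational boxes. Monotonicity of L then
   gives L((z,0),(x,t)) = gamma sqrt((x - z) t) + o(t) uniformly.

   The second-class particle is the first x >= 0 for which the supremum defining
   L_nu(x, t) is attained by exit points z >= 0. With slope
   c = gamma/2 sqrt(tan alpha), the limiting functional c z + gamma sqrt((x - z) t)
   is strictly concave in z with maximum at z = x - t / tan alpha, so this x is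
   t / tan alpha + o(t). *)

Require Import Defs.
From HB Require Import structures.
From mathcomp Require Import all_boot all_order all_algebra.
From mathcomp Require Import all_classical all_reals all_analysis.
From mathcomp Require Import measurable_realfun ring lra zify.
Import Order.TTheory GRing.Theory Num.Theory.
Import numFieldNormedType.Exports.
Set Implicit Arguments.
Unset Strict Implicit.
Unset Printing Implicit Defensive.
Local Open Scope classical_set_scope.
Local Open Scope ring_scope.

(** * Expectations of bounded random variables *)

(** The process is given through counts on finitely many disjoint sets, whereas [LPP] is a supremum
    over chains, and [sup] of an unbounded set is 0 by convention. Measurability, independence and
    almost sure finiteness must therefore be extracted from grid events before superadditivity
    becomes available.

    Second moments replace an ergodic theorem: up to telescoping squared means, doubling the box
    halves the normalised variance. This gives limits along powers of 2 only, which is enough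
    because every large [t] is within a factor 2 of such a power and the remaining bounded window is
    covered by finitely many mesh boxes. [C] has to be large so that the defect grows linearly; the
    truncation at 0 is then eventually inactive and the limit of [L] can be read off.

    The slope [c] is the derivative of [gamma * sqrt u] at [u = 1 / tan alpha], the limiting
    distance, in units of [t], from the optimal exit point to the observation point. Exit points
    much further than order [t] escape the uniform limit and need an estimate of their own. *)

Section BoundedExpectation.
Context (R : realType) (d : measure_display) (Omega : measurableType d)
  (P : probability Omega R).
Implicit Types X Y : Omega -> R.

(** Boundedness everywhere gives a class closed under sums and products on which [Ex] is linear and
    monotone. Functions of finite patterns and truncated passage times belong to it. *)
Definition bounded_rv X :=
  measurable_fun setT X /\ exists M, forall w, `|X w| <= M.

Definition Ex X : R := \int[P]_w X w.

Lemma bounded_rv_integrable X : bounded_rv X -> P.-integrable setT (EFin \o X).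
Proof.
move=> [mX [M hM]]; apply: measurable_bounded_integrable => //.
  exact: fin_num_fun_lty.
exists M; split; first exact: num_real.
by move=> x Mx w _; exact: le_trans (hM w) (ltW Mx).
Qed.

Lemma bounded_rv_cst a : bounded_rv (fun=> a).
Proof. by split => //; exists `|a|. Qed.

Lemma bounded_rvD X Y : bounded_rv X -> bounded_rv Y ->
  bounded_rv (fun w => X w + Y w).
Proof.
move=> [mX [M hM]] [mY [N hN]]; split; first exact: measurable_funD.
by exists (M + N) => w; exact: le_trans (ler_normD _ _) (lerD _ _).
Qed.

Lemma bounded_rvM X Y : bounded_rv X -> bounded_rv Y ->
  bounded_rv (fun w => X w * Y w).
Proof.
move=> [mX [M hM]] [mY [N hN]]; split; first exact: measurable_funM.
by exists (M * N) => w; rewrite normrM; exact: ler_pM.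
Qed.

Lemma bounded_rvZ a X : bounded_rv X -> bounded_rv (fun w => a * X w).
Proof. by apply: bounded_rvM; exact: bounded_rv_cst. Qed.

Lemma bounded_rvB X Y : bounded_rv X -> bounded_rv Y ->
  bounded_rv (fun w => X w - Y w).
Proof.
move=> bX bY; have := bounded_rvD bX (bounded_rvZ (-1) bY).
by under eq_fun do rewrite mulN1r.
Qed.

Lemma bounded_rv_indic A : measurable A -> bounded_rv (\1_A : Omega -> R).
Proof.
move=> mA; split; first exact: measurable_indic.
exists 1 => w; rewrite indicE; case: (_ \in _) => /=; by rewrite ?normr1 ?normr0.
Qed.

Lemma bounded_rv_sum (I : Type) (s : seq I) (X : I -> Omega -> R) :
  (forall i, bounded_rv (X i)) -> bounded_rv (fun w => \sum_(i <- s) X i w).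
Proof.
move=> bX; elim: s => [|i s IH].
  by under eq_fun do rewrite big_nil; exact: bounded_rv_cst.
by under eq_fun do rewrite big_cons; exact: bounded_rvD.
Qed.

Lemma Ex_cst a : Ex (fun=> a) = a.
Proof. 
rewrite /Ex Rintegral_cst//; transitivity (a * fine (1%E : \bar R)); last by rewrite mulr1.
by congr (_ * fine _); exact: probability_setT. Qed.

Lemma ExD X Y : bounded_rv X -> bounded_rv Y ->
  Ex (fun w => X w + Y w) = Ex X + Ex Y.
Proof. by move=> bX bY; apply: RintegralD => //; exact: bounded_rv_integrable. Qed.

Lemma ExB X Y : bounded_rv X -> bounded_rv Y ->
  Ex (fun w => X w - Y w) = Ex X - Ex Y.
Proof. by move=> bX bY; apply: RintegralB => //; exact: bounded_rv_integrable. Qed.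

Lemma ExZ a X : bounded_rv X -> Ex (fun w => a * X w) = a * Ex X.
Proof. by move=> bX; apply: RintegralZl => //; exact: bounded_rv_integrable. Qed.

Lemma Ex_ge0 X : (forall w, 0 <= X w) -> 0 <= Ex X.
Proof. by move=> X0; exact: Rintegral_ge0. Qed.

Lemma Ex_indic A : measurable A -> Ex \1_A = fine (P A).
Proof. by move=> mA; rewrite /Ex /Rintegral integral_indic// setIT. Qed.

Lemma EFin_Ex X : bounded_rv X -> (\int[P]_w (X w)%:E)%E = (Ex X)%:E.
Proof.
move=> bX; rewrite /Ex /Rintegral fineK//.
exact: integrable_fin_num (bounded_rv_integrable bX).
Qed.

(** On the null set [N] the bounds of [X] and [Y] are paid for: adding [(A + B) * \1_N] to [Y] makes
    the inequality hold everywhere and leaves the expectation unchanged. *)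
Lemma Ex_le_ae X Y : bounded_rv X -> bounded_rv Y ->
  {ae P, forall w, X w <= Y w} -> Ex X <= Ex Y.
Proof.
move=> bX bY [N [mN N0 hN]].
have bI : bounded_rv (\1_N : Omega -> R) by exact: bounded_rv_indic.
have [_ [A hA]] := bX; have [_ [B hB]] := bY.
suff : Ex X <= Ex (fun w => Y w + (A + B) * \1_N w).
  by rewrite ExD// ?ExZ// ?Ex_indic ?N0 ?mulr0 ?addr0//; exact: bounded_rvZ.
apply: le_Rintegral => //; first exact: bounded_rv_integrable.
  by apply: bounded_rv_integrable; apply: bounded_rvD => //; exact: bounded_rvZ.
move=> w _; have [XY|XY] := pselect (X w <= Y w).
  rewrite (le_trans XY)// lerDl mulr_ge0// addr_ge0//.
    exact: le_trans (hA w).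
  exact: le_trans (hB w).
rewrite indicE mem_set; last exact: hN.
rewrite mulr1; have := hA w; have := hB w.
rewrite !ler_norml => /andP[? ?] /andP[? ?]; lra.
Qed.

Lemma Ex_le X Y : bounded_rv X -> bounded_rv Y ->
  (forall w, X w <= Y w) -> Ex X <= Ex Y.
Proof. by move=> bX bY h; apply: Ex_le_ae => //; exact: aeW. Qed.

Lemma Ex_sum (I : Type) (s : seq I) (X : I -> Omega -> R) :
  (forall i, bounded_rv (X i)) ->
  Ex (fun w => \sum_(i <- s) X i w) = \sum_(i <- s) Ex (X i).
Proof.
move=> bX; elim: s => [|i s IH].
  by under eq_fun do rewrite big_nil; rewrite Ex_cst big_nil.
under eq_fun do rewrite big_cons.
by rewrite ExD// ?IH ?big_cons//; exact: bounded_rv_sum.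
Qed.

Lemma Ex_cvg (X_ : nat -> Omega -> R) X M :
  (forall n, measurable_fun setT (X_ n)) -> measurable_fun setT X ->
  (forall n w, `|X_ n w| <= M) ->
  {ae P, forall w, X_ n w @[n --> \oo] --> X w} ->
  Ex (X_ n) @[n --> \oo] --> Ex X.
Proof.
move=> mX_ mX hM cX.
have [] := @dominated_convergence _ _ _ P setT measurableT
  (fun n w => (X_ n w)%:E) (fun w => (X w)%:E) (fun=> M%:E).
- by move=> n; exact/measurable_EFinP.
- exact/measurable_EFinP.
- by apply: filterS cX => w cw _; apply/cvg_EFin => //; apply: nearW.
- by apply: bounded_rv_integrable; exact: bounded_rv_cst.
- by apply: aeW => w n _ /=; rewrite lee_fin; exact: hM.
move=> iX _ h; rewrite /Ex /Rintegral; apply: fine_cvg.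
by rewrite fineK//; exact: integrable_fin_num.
Qed.

End BoundedExpectation.

(** * Hitting events of a Poisson set *)

Section HitLaw.
Context (R : realType) (d d' : measure_display) (Omega : measurableType d)
  (X : measurableType d') (P : probability Omega R) (Pi : Omega -> set X)
  (mu : {measure set X -> \bar R}).

Definition miss (A : set X) : set Omega := [set w | Pi w `&` A = set0].
Definition hit (A : set X) : set Omega := ~` miss A.

(** The form in which the Poisson property enters all the laws below: void probabilities of sets of
    finite intensity. *)
Definition miss_law := forall A, measurable A -> (mu A < +oo)%E ->
  measurable (miss A) /\ P (miss A) = (expR (- fine (mu A)))%:E.

Hypothesis hmiss : miss_law.

Lemma missU A B : miss (A `|` B) = miss A `&` miss B.
Proof.
apply/seteqP; split => w; rewrite /miss /= setIUr.
  by move=> h; split; apply/seteqP; split => // x hx; rewrite -h; [left|right].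
by move=> [-> ->]; rewrite setU0.
Qed.

Lemma measurable_miss A : measurable A -> (mu A < +oo)%E -> measurable (miss A).
Proof. by move=> mA fA; case: (hmiss mA fA). Qed.

Lemma measurable_hit A : measurable A -> (mu A < +oo)%E -> measurable (hit A).
Proof. by move=> mA fA; apply: measurableC; exact: measurable_miss. Qed.

Definition hit_all (T : eqType) (A : T -> set X) (s : seq T) : set Omega :=
  [set w | forall c, c \in s -> hit (A c) w].

Lemma hit_all_cons (T : eqType) (A : T -> set X) c s :
  hit_all A (c :: s) = hit (A c) `&` hit_all A s.
Proof.
apply/seteqP; split => w /=.
  move=> h; split; first by apply: h; rewrite mem_head.
  by move=> x xs; apply: h; rewrite in_cons xs orbT.
by move=> [h1 h2] x; rewrite in_cons => /orP[/eqP->//|]; exact: h2.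
Qed.

Lemma hit_all_nil (T : eqType) (A : T -> set X) : hit_all A [::] = setT.
Proof. by apply/seteqP; split. Qed.

Lemma measurable_hit_all (T : eqType) (A : T -> set X) s :
  (forall c, c \in s -> measurable (A c)) ->
  (forall c, c \in s -> (mu (A c) < +oo)%E) -> measurable (hit_all A s).
Proof.
elim: s => [|c s IH] mA fA; first by rewrite hit_all_nil.
rewrite hit_all_cons; apply: measurableI.
  by apply: measurable_hit; [exact: (mA c (mem_head _ _))|exact: (fA c (mem_head _ _))].
by apply: IH => x xs; [apply: mA|apply: fA]; rewrite in_cons xs orbT.
Qed.

(* Renyi's theorem, by inclusion-exclusion on the cells required to be hit:
   void probabilities alone determine the joint law of the hitting events. *)
Lemma prob_miss_hit_all (T : eqType) (A : T -> set X) (s : seq T) (Z : set X) :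
  uniq s ->
  (forall c, c \in s -> measurable (A c)) ->
  (forall c, c \in s -> (mu (A c) < +oo)%E) ->
  {in s &, forall b c, b != c -> A b `&` A c = set0} ->
  measurable Z -> (mu Z < +oo)%E ->
  (forall c, c \in s -> Z `&` A c = set0) ->
  P (miss Z `&` hit_all A s) =
  (expR (- fine (mu Z)) * \prod_(c <- s) (1 - expR (- fine (mu (A c)))))%:E.
Proof.
elim: s Z => [|c s IH] Z /=.
  by move=> _ _ _ _ mZ fZ _; rewrite hit_all_nil setIT big_nil mulr1; case: (hmiss mZ fZ).
move=> /andP[cs us] mA fA dA mZ fZ dZ.
have cin := mem_head c s.
have sin x : x \in s -> x \in c :: s by rewrite in_cons => ->; rewrite orbT.
have mh : measurable (hit_all A s).
  by apply: measurable_hit_all => x xs; [exact: mA (sin _ xs)|exact: fA (sin _ xs)].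
have IHs Z' : measurable Z' -> (mu Z' < +oo)%E ->
  (forall c, c \in s -> Z' `&` A c = set0) -> P (miss Z' `&` hit_all A s) =
  (expR (- fine (mu Z')) * \prod_(c <- s) (1 - expR (- fine (mu (A c)))))%:E.
  move=> mZ' fZ' dZ'; apply: IH => //.
  - by move=> x xs; exact: mA (sin _ xs).
  - by move=> x xs; exact: fA (sin _ xs).
  - by move=> x y xs ys; apply: dA; exact: sin.
have muU : mu (Z `|` A c) = (mu Z + mu (A c))%E.
  by rewrite measureU//; [exact: mA|exact: dZ].
have fc := fA c cin.
have fU : (mu (Z `|` A c) < +oo)%E by rewrite muU lte_add_pinfty.
(* Missing [Z] and hitting [A c] is missing [Z] without missing both; the induction hypothesis
   applies to the void [Z] and to the void enlarged by [A c]. *)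
have -> : miss Z `&` hit_all A (c :: s) =
    (miss Z `&` hit_all A s) `\` (miss (Z `|` A c) `&` hit_all A s).
  rewrite hit_all_cons missU; apply/seteqP; split => w /=.
    by move=> [h1 [h2 h3]]; split => // -[[_ h] _].
  by move=> [[h1 h3] h]; split => //; split => // h'; apply: h.
have mV := measurable_miss mZ fZ.
have mU : measurable (Z `|` A c) by apply: measurableU => //; exact: mA.
have mV' := measurable_miss mU fU.
rewrite measureD; [|exact: measurableI|exact: measurableI|].
  rewrite [X in (_ - P X)%E](_ : _ = miss (Z `|` A c) `&` hit_all A s); last first.
    by rewrite missU; apply/seteqP; split => w /=; [move=> [_ //]|move=> [[? ?] ?]].
  have E1 : P (miss Z `&` hit_all A s) = (expR (- fine (mu Z)) *
      \prod_(c <- s) (1 - expR (- fine (mu (A c)))))%:E.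
    by apply: IHs => // x xs; exact: dZ (sin _ xs).
  have E2 : P (miss (Z `|` A c) `&` hit_all A s) = (expR (- fine (mu (Z `|` A c))) *
      \prod_(c <- s) (1 - expR (- fine (mu (A c)))))%:E.
    apply: IHs => // x xs.
    rewrite setIUl dZ ?sin// set0U dA// ?sin//.
    by apply: contraNneq cs => ->.
  apply: etrans; first exact: (congr2 (fun a b => (a - b)%E) E1 E2).
  rewrite muU fineD ?ge0_fin_numE// opprD expRD big_cons. rewrite -EFinB; congr EFin; ring.
by rewrite (le_lt_trans (probability_le1 _ _)) ?ltry//; exact: measurableI.
Qed.

Section FinType.
Variables (T : finType) (A : T -> set X).
Hypotheses (mA : forall c, measurable (A c)) (fA : forall c, (mu (A c) < +oo)%E).
Hypothesis dA : forall b c, b != c -> A b `&` A c = set0.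

Definition pattern (w : Omega) : {ffun T -> bool} := [ffun c => `[< hit (A c) w >]].

Definition pattern_prob (m : T -> R) (b : {ffun T -> bool}) : R :=
  \prod_c (if b c then 1 - expR (- m c) else expR (- m c)).

Lemma measurable_pattern b : measurable [set w | pattern w = b].
Proof.
have -> : [set w | pattern w = b] =
    \bigcap_(c in [set: T]) (if b c then hit (A c) else miss (A c)).
  apply/seteqP; split => w /=.
    move=> <- c _; rewrite ffunE; case: asboolP => // h.
    by apply: contrapT => h'; apply: h.
  move=> h; apply/ffunP => c; rewrite ffunE; have := h c I.
  by case: (b c) => h'; [exact/asboolP|apply/asboolP => /(_ h')].
apply: fin_bigcap_measurable => [|c _]; first exact: finite_finset.
by case: (b c); [exact: measurable_hit|exact: measurable_miss].
Qed.


(** The cells marked [false] are merged into a single void [Z], and those marked [true] form the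
    list of cells to be hit. *)
Lemma prob_pattern b :
  P [set w | pattern w = b] = (pattern_prob (fun c => fine (mu (A c))) b)%:E.
Proof.
pose Z := \big[setU/set0]_(c | ~~ b c) A c.
pose s := [seq c <- index_enum T | b c].
have mZ : measurable Z by apply: bigsetU_measurable => c _; exact: mA.
have muZ : mu Z = \sum_(c | ~~ b c) mu (A c).
  rewrite /Z -big_filter -[RHS]big_filter.
  have : uniq [seq c <- index_enum T | ~~ b c] by rewrite filter_uniq ?index_enum_uniq.
  elim: [seq c <- index_enum T | ~~ b c] => [|c r IH] /=.
    by rewrite !big_nil measure0.
  move=> /andP[cr ur]; rewrite !big_cons measureU//.
  - by congr (_ + _)%E; exact: IH.
  - by apply: bigsetU_measurable => x _; exact: mA.
  - elim: r cr {IH ur} => [|x r IH]; first by rewrite big_nil setI0.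
    rewrite in_cons negb_or => /andP[cx cr].
    by rewrite big_cons setIUr IH// dA// setU0.
have fZ : (mu Z < +oo)%E by rewrite muZ; apply: lte_sum_pinfty => c _; exact: fA.
have fmuZ : fine (mu Z) = \sum_(c | ~~ b c) fine (mu (A c)).
  by rewrite muZ sum_fine// => c _; rewrite ge0_fin_numE.
have Zin c x : ~~ b c -> A c x -> Z x.
  move=> bc Ax; rewrite /Z -bigcup_seq_cond; exists c => //=.
  by rewrite mem_index_enum.
have inZ x : Z x -> exists2 c, ~~ b c & A c x.
  by rewrite /Z -bigcup_seq_cond => -[c /= /andP[_ bc] Ac]; exists c.
have -> : [set w | pattern w = b] = miss Z `&` hit_all A s.
  apply/seteqP; split => w /=.
    move=> pwb; split => [|c].
      apply/seteqP; split => // x [Px /inZ[c bc Ax]].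
      apply: (negP bc); rewrite -pwb ffunE; apply/asboolP => v.
      by have : (Pi w `&` A c) x by []; rewrite v.
    rewrite mem_filter => /andP[bc _].
    by move: bc; rewrite -pwb ffunE => /asboolP.
  move=> [vZ hs]; apply/ffunP => c; rewrite ffunE.
  have [bc|bc] := boolP (b c).
    by apply/asboolP; apply: hs; rewrite mem_filter bc mem_index_enum.
  apply/asboolP => h; apply: h; apply/seteqP; split => // x [Px Ax].
  by rewrite -vZ; split => //; exact: Zin bc Ax.
rewrite prob_miss_hit_all//.
- congr EFin; rewrite fmuZ -sumrN expR_sum big_filter /pattern_prob.
  rewrite [RHS](bigID (fun c => b c))/= mulrC.
  by congr (_ * _); [apply: eq_bigr => c ->|apply: eq_bigr => c /negbTE ->].
- by rewrite filter_uniq// index_enum_uniq.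
- by move=> x y _ _; exact: dA.
- move=> c; rewrite mem_filter => /andP[bc _].
  rewrite /Z; elim: (index_enum T) => [|x r IH]; first by rewrite big_nil set0I.
  rewrite big_cons; case: ifPn => // bx.
  rewrite setIUl IH setU0 dA//.
  by apply: contraNneq bx => ->.
Qed.

(** The pattern takes finitely many values, so any function of it is a finite combination of
    indicators, whatever [h] is. *)
Lemma expect_pattern (h : {ffun T -> bool} -> R) :
  bounded_rv (fun w => h (pattern w)) /\
  Ex P (fun w => h (pattern w)) =
  \sum_b h b * pattern_prob (fun c => fine (mu (A c))) b.
Proof.
have hE w : h (pattern w) = \sum_b h b * \1_[set w | pattern w = b] w.
  rewrite (bigD1 (pattern w))//= indicE mem_set// mulr1 big1 ?addr0// => b bw.
  by rewrite indicE memNset ?mulr0// => /eqP; rewrite eq_sym (negbTE bw).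
have bI b : bounded_rv (\1_[set w | pattern w = b] : Omega -> R).
  exact/bounded_rv_indic/measurable_pattern.
split; first by under eq_fun do rewrite hE; apply: bounded_rv_sum => b; exact: bounded_rvZ.
rewrite (_ : (fun w => _) = (fun w => \sum_b h b * \1_[set w | pattern w = b] w)); last exact/funext.
rewrite Ex_sum; last by move=> b; exact: bounded_rvZ.
apply: eq_bigr => b _; rewrite ExZ// Ex_indic; last exact: measurable_pattern.
by have -> := prob_pattern b.
Qed.

End FinType.

(** The two disjoint families form one family indexed by the sum type, and the probability of a
    joint pattern is a product over the two summands. *)
Lemma expect_pattern_indep (T T' : finType) (A : T -> set X) (A' : T' -> set X)
  (h : {ffun T -> bool} -> R) (h' : {ffun T' -> bool} -> R) :
  (forall c, measurable (A c)) -> (forall c, (mu (A c) < +oo)%E) ->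
  (forall b c, b != c -> A b `&` A c = set0) ->
  (forall c, measurable (A' c)) -> (forall c, (mu (A' c) < +oo)%E) ->
  (forall b c, b != c -> A' b `&` A' c = set0) ->
  (forall b c, A b `&` A' c = set0) ->
  Ex P (fun w => h (pattern A w) * h' (pattern A' w)) =
  Ex P (fun w => h (pattern A w)) * Ex P (fun w => h' (pattern A' w)).
Proof.
move=> mA fA dA mA' fA' dA' dAA'.
pose S := (T + T')%type.
pose B (c : S) := match c with inl c => A c | inr c => A' c end.
pose l (b : {ffun S -> bool}) : {ffun T -> bool} := [ffun c => b (inl c)].
pose r (b : {ffun S -> bool}) : {ffun T' -> bool} := [ffun c => b (inr c)].
pose j (bb : {ffun T -> bool} * {ffun T' -> bool}) : {ffun S -> bool} :=
  [ffun c => match c with inl c => bb.1 c | inr c => bb.2 c end].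
have lP w : l (pattern B w) = pattern A w by apply/ffunP => c; rewrite !ffunE.
have rP w : r (pattern B w) = pattern A' w by apply/ffunP => c; rewrite !ffunE.
have [_ E] : bounded_rv (fun w => h (l (pattern B w)) * h' (r (pattern B w))) /\
   Ex P (fun w => h (l (pattern B w)) * h' (r (pattern B w))) =
   \sum_b (h (l b) * h' (r b)) * pattern_prob (fun c => fine (mu (B c))) b.
  apply: (expect_pattern (A := B) _ _ _ (fun b => h (l b) * h' (r b))).
  - by case.
  - by case.
  - move=> [b|b] [c|c] bc /=; rewrite ?dAA' ?dA ?dA'//.
    by rewrite setIC dAA'.
under eq_fun do rewrite -lP -rP.
rewrite E (proj2 (expect_pattern mA fA dA h)) (proj2 (expect_pattern mA' fA' dA' h')).
rewrite big_distrlr/= pair_big/=.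
rewrite (reindex j)/=; last first.
  exists (fun b => (l b, r b)) => [[b b'] _|b _].
    by congr pair; apply/ffunP => c; rewrite !ffunE.
  by apply/ffunP => -[c|c]; rewrite !ffunE.
apply: eq_bigr => -[b b'] _ /=.
have -> : l (j (b, b')) = b by apply/ffunP => c; rewrite !ffunE.
have -> : r (j (b, b')) = b' by apply/ffunP => c; rewrite !ffunE.
have -> : pattern_prob (fun c => fine (mu (B c))) (j (b, b')) =
  pattern_prob (fun c => fine (mu (A c))) b * pattern_prob (fun c => fine (mu (A' c))) b'.
  by rewrite /pattern_prob big_sumType/=; congr (_ * _); apply: eq_bigr => c _; rewrite ffunE.
ring.
Qed.

End HitLaw.

(** * Grid approximation of chains *)

Lemma ler_sum_in (R : numDomainType) (I : eqType) (s : seq I) (f g : I -> R) :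
  (forall i, i \in s -> f i <= g i) -> \sum_(i <- s) f i <= \sum_(i <- s) g i.
Proof. by move=> fg; rewrite !big_seq; exact: ler_sum. Qed.

Section Grid.
Context (R : realType).
Implicit Types (p q : R * R) (n : nat) (C : set (Pt R)).

(** Columns, rows and weight levels. The levels have height [1 / n.+1] and there are [n.+1 ^ 2] of
    them, so they cover the weights in []0, n.+1]]: as [n] grows the mesh vanishes and the range
    exhausts the positive weights. *)
Definition cellT n : finType := ('I_n.+1 * 'I_n.+1 * 'I_(n.+1 * n.+1))%type.

Definition cell p q n (c : cellT n) : set (Pt R) :=
  let dx := (q.1 - p.1) / n.+1%:R in
  let dy := (q.2 - p.2) / n.+1%:R in
  (`]p.1 + c.1.1%:R * dx, p.1 + c.1.1.+1%:R * dx]%classic `*`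
   `]p.2 + c.1.2%:R * dy, p.2 + c.1.2.+1%:R * dy]%classic) `*`
  `]c.2%:R / n.+1%:R, c.2.+1%:R / n.+1%:R]%classic.

Lemma cellP p q n (c : cellT n) (z : Pt R) : cell p q c z <->
  [/\ p.1 + c.1.1%:R * ((q.1 - p.1) / n.+1%:R) < z.1.1
        <= p.1 + c.1.1.+1%:R * ((q.1 - p.1) / n.+1%:R),
      p.2 + c.1.2%:R * ((q.2 - p.2) / n.+1%:R) < z.1.2
        <= p.2 + c.1.2.+1%:R * ((q.2 - p.2) / n.+1%:R) &
      c.2%:R / n.+1%:R < z.2 <= c.2.+1%:R / n.+1%:R].
Proof.
split; first by move=> [[/= a b] h]; rewrite !in_itv/= in a b h.
by move=> [a b h]; split; [split|] => /=; rewrite in_itv.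
Qed.

Definition lt_cell n (c c' : cellT n) : bool :=
  (c.1.1 < c'.1.1)%N && (c.1.2 < c'.1.2)%N.

(** The lower end of the weight level, so that rounding never increases a sum. *)
Definition cell_weight n (c : cellT n) : R := c.2%:R / n.+1%:R.

(* The value of a configuration of occupied cells only counts chains of cells
   increasing strictly in both indices, so it never exceeds the true value. *)
Definition grid_sums n (b : {ffun cellT n -> bool}) : set R :=
  [set \sum_(c <- s) cell_weight c | s in [set s | sorted (@lt_cell n) s /\ all b s]].

Definition grid_lpp n (b : {ffun cellT n -> bool}) : R := sup (grid_sums b).

Definition chain C p q (s : seq (Pt R)) : Prop :=
  sorted (@lt_pt R) s /\ forall z, z \in s -> C z /\ in_rect p q z.

Definition chain_sums C p q : set R := [set \sum_(z <- s) z.2 | s in chain C p q].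

Lemma LPP_chain_sums C p q : LPP C p q = sup (chain_sums C p q).
Proof. by []. Qed.

Lemma lt_cell_trans n : transitive (@lt_cell n).
Proof.
by move=> y x z /andP[a b] /andP[c e]; apply/andP; split; [exact: ltn_trans a c|exact: ltn_trans b e].
Qed.

Lemma lt_cell_irr n : irreflexive (@lt_cell n).
Proof. by move=> x; rewrite /lt_cell ltnn. Qed.

Lemma lt_pt_trans : transitive (@lt_pt R).
Proof.
by move=> y x z /andP[a b] /andP[c e]; apply/andP; split; [exact: lt_trans a c|exact: lt_trans b e].
Qed.

Lemma cell_weight_ge0 n (c : cellT n) : 0 <= cell_weight c.
Proof. by rewrite divr_ge0. Qed.

Lemma has_sup_grid_sums n (b : {ffun cellT n -> bool}) : has_sup (grid_sums b).
Proof.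
split; first by exists 0, [::] => //=; rewrite big_nil.
exists (\sum_(c : cellT n) cell_weight c) => _ [s [ss _] <-].
have us : uniq s by exact: sorted_uniq (@lt_cell_trans n) (@lt_cell_irr n) _ ss.
rewrite big_uniq//= [leRHS](bigID (mem s))/= lerDl sumr_ge0// => c _.
exact: cell_weight_ge0.
Qed.

Lemma grid_lpp_ge0 n (b : {ffun cellT n -> bool}) : 0 <= grid_lpp b.
Proof.
apply: ub_le_sup; first by case: (has_sup_grid_sums b).
by exists [::] => //=; rewrite big_nil.
Qed.

Lemma grid_lpp_ge n (b : {ffun cellT n -> bool}) s :
  sorted (@lt_cell n) s -> all b s -> \sum_(c <- s) cell_weight c <= grid_lpp b.
Proof.
by move=> ss bs; apply: ub_le_sup; [case: (has_sup_grid_sums b)|exists s].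
Qed.

Lemma chain_filter C p q s (a : pred (Pt R)) : chain C p q s -> chain C p q [seq z <- s | a z].
Proof.
move=> [ss hs]; split; first exact: sorted_filter lt_pt_trans _ _ ss.
by move=> z; rewrite mem_filter => /andP[_ /hs].
Qed.

Definition is_hit C n p q (b : {ffun cellT n -> bool}) :=
  forall c, b c <-> C `&` cell p q c !=set0.

(** One point is picked in each occupied cell. Strict growth of both indices makes the points
    strictly ordered, and every weight exceeds the lower end of its level. *)
Lemma chain_of_grid C p q n (b : {ffun cellT n -> bool}) s :
  p.1 < q.1 -> p.2 < q.2 -> is_hit C p q b ->
  sorted (@lt_cell n) s -> all b s ->
  exists2 s', chain C p q s' & \sum_(c <- s) cell_weight c <= \sum_(z <- s') z.2.
Proof.
move=> pq1 pq2 hb ss bs.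
pose f (c : cellT n) : Pt R := xget ((0, 0), 0) (C `&` cell p q c).
have fP (c : cellT n) : b c -> (C `&` cell p q c) (f c).
  by move=> /hb[z hz]; rewrite /f; case: xgetP => // /(_ z).
have dx0 : 0 < (q.1 - p.1) / n.+1%:R by rewrite divr_gt0// subr_gt0.
have dy0 : 0 < (q.2 - p.2) / n.+1%:R by rewrite divr_gt0// subr_gt0.
exists (map f s).
  split.
    apply: (@homo_sorted_in _ _ [pred c | b c] f (@lt_cell n) _ s _ bs ss).
    move=> c c' bc bc' /andP[i j]; rewrite inE in bc; rewrite inE in bc'.
    have [_ /cellP[/andP[_ u1] /andP[_ u2] _]] := fP _ bc.
    have [_ /cellP[/andP[v1 _] /andP[v2 _] _]] := fP _ bc'.
    apply/andP; split.
      by apply: le_lt_trans u1 (le_lt_trans _ v1); rewrite lerD2l ler_pM2r// ler_nat.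
    by apply: le_lt_trans u2 (le_lt_trans _ v2); rewrite lerD2l ler_pM2r// ler_nat.
  move=> _ /mapP[c cs ->]; have bc := allP bs _ cs.
  have [Cf /cellP[/andP[u1 u2] /andP[v1 v2] _]] := fP _ bc.
  split=> //; rewrite /in_rect.
  have h (a e : R) (i : 'I_n.+1) : a < e -> a <= a + i%:R * ((e - a) / n.+1%:R) /\
      a + i.+1%:R * ((e - a) / n.+1%:R) <= e.
    move=> ae; split; first by rewrite lerDl mulr_ge0// divr_ge0// subr_ge0 ltW.
    rewrite -lerBrDl mulrCA ler_piMr ?subr_ge0 ?(ltW ae)//.
    by rewrite ler_pdivrMr// mul1r ler_nat.
  have [h1 h2] := h _ _ c.1.1 pq1; have [h3 h4] := h _ _ c.1.2 pq2.
  split; apply/andP; split.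
  - exact: le_lt_trans h1 u1.
  - exact: le_trans u2 h2.
  - exact: le_lt_trans h3 v1.
  - exact: le_trans v2 h4.
rewrite big_map ler_sum_in// => c cs.
by have [_ /cellP[_ _ /andP[/ltW]]] := fP _ (allP bs _ cs).
Qed.

Lemma near_all_seq (I : eqType) (s : seq I) (Q : I -> nat -> Prop) :
  (forall z, z \in s -> \forall n \near \oo, Q z n) ->
  \forall n \near \oo, forall z, z \in s -> Q z n.
Proof.
elim: s => [|x s IH] h; first by near=> n.
have h1 := h x (mem_head _ _).
have h2 : \forall n \near \oo, forall z, z \in s -> Q z n.
  by apply: IH => z zs; apply: h; rewrite in_cons zs orbT.
near=> n => z; rewrite in_cons => /orP[/eqP ->|zs].
  by near: n.
by move: z zs; near: n.
Unshelve. all: by end_near.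
Qed.

(* the [i] such that [x] lies in [`]i, i + 1]], for [0 < x] *)
Definition ceil_idx (x : R) : nat := `|Num.ceil x|%N.-1.

Lemma ceil_idxP x : 0 < x -> (ceil_idx x)%:R < x /\ x <= (ceil_idx x).+1%:R.
Proof.
move=> x0; have c0 : 0 < Num.ceil x by rewrite ceil_gt0.
have e : (`|Num.ceil x|%N)%:R = (Num.ceil x)%:~R :> R.
  by rewrite natr_absz gtr0_norm.
have e1 : `|Num.ceil x|%N = (ceil_idx x).+1 by rewrite /ceil_idx prednK// absz_gt0 gt_eqF.
split; last by rewrite -e1 e ceil_ge.
have /andP[+ _] := ceil_itv x.
by rewrite intrD -e e1 mulrSr rmorphN1 addrK.
Qed.

Lemma ceil_idx_lt x n : 0 < x -> x <= n%:R -> (ceil_idx x < n)%N.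
Proof.
by move=> x0 xn; rewrite -(ltr_nat R); apply: lt_le_trans xn; case: (ceil_idxP x0).
Qed.

Lemma ceil_idx_ltn x y : 0 < x -> 1 <= y - x -> (ceil_idx x < ceil_idx y)%N.
Proof.
move=> x0 xy; have y0 : 0 < y by lra.
have [h1 h2] := ceil_idxP x0; have [h3 h4] := ceil_idxP y0.
rewrite -ltnS -(ltr_nat R) mulrSr [X in _ < X]mulrSr ltrD2r -[X in X < _]addr0.
move: h4; rewrite mulrSr; lra.
Qed.

Lemma near_ge_nat (x : R) : \forall n \near \oo, x <= n.+1%:R.
Proof.
exists (Num.truncn x).+1 => // n /= xn; have := truncnS_gt x.
move=> /ltW /le_trans; apply; rewrite ler_nat; exact: leqW.
Qed.

(** A finite chain has positive gaps and bounded weights. Once the mesh is finer than the gaps, its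
    points lie in strictly increasing cells, and rounding the weights down costs at most
    [size s / n.+1] in total. *)
Lemma grid_of_chain C p q s (e : R) :
  p.1 < q.1 -> p.2 < q.2 -> chain C p q s -> (forall z, z \in s -> 0 < z.2) -> 0 < e ->
  \forall n \near \oo, forall b : {ffun cellT n -> bool}, is_hit C p q b ->
  exists s', [/\ sorted (@lt_cell n) s', all b s' &
                \sum_(z <- s) z.2 <= \sum_(c <- s') cell_weight c + e].
Proof.
move=> pq1 pq2 [ss hs] ws e0.
have sep (f : Pt R -> R) (L : R) : \forall n \near \oo, forall z, z \in s ->
    forall z', z' \in s -> f z < f z' -> L <= (f z' - f z) * n.+1%:R.
  apply: near_all_seq => z zs; apply: near_all_seq => z' zs'.
  have [fzz|fzz] := ltP (f z) (f z'); last by near=> n.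
  have := near_ge_nat (L / (f z' - f z)); apply: filterS => n.
  by rewrite ler_pdivrMr ?subr_gt0// mulrC.
have A1 := sep (fun z => z.1.1) (q.1 - p.1).
have A2 := sep (fun z => z.1.2) (q.2 - p.2).
have A3 : \forall n \near \oo, forall z, z \in s -> z.2 <= n.+1%:R.
  by apply: near_all_seq => z zs; exact: near_ge_nat.
have A4 := near_ge_nat ((size s)%:R / e).
near=> n => b hb.
have B1 : forall z, z \in s -> forall z', z' \in s -> z.1.1 < z'.1.1 ->
   q.1 - p.1 <= (z'.1.1 - z.1.1) * n.+1%:R by near: n.
have B2 : forall z, z \in s -> forall z', z' \in s -> z.1.2 < z'.1.2 ->
   q.2 - p.2 <= (z'.1.2 - z.1.2) * n.+1%:R by near: n.
have B3 : forall z, z \in s -> z.2 <= n.+1%:R by near: n.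
have B4 : (size s)%:R <= n.+1%:R * e by rewrite -ler_pdivrMr//; near: n.
pose N : R := n.+1%:R.
have N0 : 0 < N by rewrite ltr0n.
have Nn0 : N != 0 by rewrite gt_eqF.
pose dx := (q.1 - p.1) / N; pose dy := (q.2 - p.2) / N.
have dx0 : 0 < dx by rewrite divr_gt0// subr_gt0.
have dy0 : 0 < dy by rewrite divr_gt0// subr_gt0.
pose gx (z : Pt R) := ceil_idx ((z.1.1 - p.1) / dx).
pose gy (z : Pt R) := ceil_idx ((z.1.2 - p.2) / dy).
pose gw (z : Pt R) := ceil_idx (z.2 * N).
(* [inord] and [insubd] fall back on a default index when out of range; [gxE], [gyE] and [gwE] show
   that this never happens for points of [s]. *)
pose g z : cellT n := (inord (gx z), inord (gy z), insubd ord0 (gw z)).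
have posx z : z \in s -> 0 < (z.1.1 - p.1) / dx /\ (z.1.1 - p.1) / dx <= N.
  move=> /hs[_ [/andP[h1 h2] _]]; rewrite divr_gt0 ?subr_gt0//; split => //.
  by rewrite ler_pdivrMr// /dx mulrC divfK// lerB.
have posy z : z \in s -> 0 < (z.1.2 - p.2) / dy /\ (z.1.2 - p.2) / dy <= N.
  move=> /hs[_ [_ /andP[h1 h2]]]; rewrite divr_gt0 ?subr_gt0//; split => //.
  by rewrite ler_pdivrMr// /dy mulrC divfK// lerB.
have gxE z : z \in s -> (inord (gx z) : 'I_n.+1) = gx z :> nat.
  by move=> /posx[h1 h2]; rewrite inordK// /gx ceil_idx_lt.
have gyE z : z \in s -> (inord (gy z) : 'I_n.+1) = gy z :> nat.
  by move=> /posy[h1 h2]; rewrite inordK// /gy ceil_idx_lt.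
have posw z : z \in s -> 0 < z.2 * N by move=> zs; rewrite mulr_gt0// ws.
have gwE z : z \in s -> (insubd ord0 (gw z) : 'I_(n.+1 * n.+1)) = gw z :> nat.
  move=> zs; rewrite val_insubd ifT// /gw ceil_idx_lt//; first exact: posw.
  by rewrite natrM ler_pM2r// B3.
exists (map g s); split.
- apply: (@homo_sorted_in _ _ (mem s) g (@lt_pt R) _ s _ _ ss); last exact/allP.
  move=> z z' zs zs' /andP[h1 h2]; rewrite /lt_cell /= !gxE// !gyE//.
  apply/andP; split; apply: ceil_idx_ltn.
  + by case: (posx _ zs).
  + rewrite -mulrBl ler_pdivlMr// mul1r opprB addrA subrK.
    by rewrite /dx ler_pdivrMr//; exact: B1.
  + by case: (posy _ zs).
  + rewrite -mulrBl ler_pdivlMr// mul1r opprB addrA subrK.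
    by rewrite /dy ler_pdivrMr//; exact: B2.
- apply/allP => _ /mapP[z zs ->]; apply/hb; exists z.
  have [Cz _] := hs _ zs; split => //.
  have [a1 _] := posx _ zs; have [a2 _] := posy _ zs.
  have [b1 c1] := ceil_idxP a1; have [b2 c2] := ceil_idxP a2.
  have [b3 c3] := ceil_idxP (posw _ zs).
  apply/cellP; rewrite /= gxE// gyE// gwE//; split; apply/andP; split.
  + by rewrite -ltrBrDl -ltr_pdivlMr.
  + by rewrite -lerBlDl -ler_pdivrMr.
  + by rewrite -ltrBrDl -ltr_pdivlMr.
  + by rewrite -lerBlDl -ler_pdivrMr.
  + by rewrite ltr_pdivrMr.
  + by rewrite ler_pdivlMr.
- rewrite big_map; apply: (@le_trans _ _ (\sum_(z <- s) (cell_weight (g z) + N^-1))).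
    rewrite ler_sum_in// => z zs.
    rewrite /cell_weight /= gwE//.
    have -> : (gw z)%:R / n.+1%:R + N^-1 = (gw z).+1%:R / N by rewrite [(gw z).+1%:R]mulrSr mulrDl mul1r.
    rewrite ler_pdivlMr//.
    by have [] := ceil_idxP (posw _ zs).
  rewrite big_split/= lerD2l big_const_seq count_predT iter_addr_0 -mulr_natl.
  by rewrite ler_pdivrMr// mulrC.
Unshelve. all: by end_near.
Qed.

End Grid.

(** * Law of the last-passage time *)

Section Intensity.
Context (R : realType) (F : probability R R).

(* Same carrier and same measurable sets as [Pt R]; only the display differs,
   which is that of the domain of [lebesgue_measure]. *)
Definition markedPt : measurableType _ :=
  ((measurableTypeR R * measurableTypeR R) * R)%type.

Definition intensity_measure : {measure set markedPt -> \bar R} :=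
  ((@lebesgue_measure R \x @lebesgue_measure R) \x F)%E.

Lemma intensity_box (a b c d : R) (U : set R) : a <= b -> c <= d -> measurable U ->
  intensity_measure ((`]a, b]%classic `*` `]c, d]%classic) `*` U) =
  (((b - a) * (d - c))%:E * F U)%E.
Proof.
move=> ab cd mU.
have L (x y : R) : x <= y -> lebesgue_measure `]x, y]%classic = (y - x)%:E :> \bar R.
  move=> xy; rewrite lebesgue_measure_itv/= lte_fin.
  by move: xy; rewrite le_eqVlt => /predU1P[->|->//]; rewrite ltxx subrr.
rewrite /intensity_measure [LHS]product_measure1E//; last exact: measurableX.
apply: (@etrans _ _ (lebesgue_measure `]a, b]%classic * lebesgue_measure `]c, d]%classic * F U)%E).
  congr (_ * _)%E; exact: product_measure1E.
by rewrite !L// EFinM.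
Qed.

Context (d : measure_display) (Omega : measurableType d)
    (P : probability Omega R) (Pi : Omega -> set (Pt R)).

(** The definition is applied to one set and the count 0. [counting] is infinite on infinite sets,
    so a zero count does mean an empty intersection. *)
Lemma poisson_miss_law : is_poisson_process P Pi (intensity F) ->
  @miss_law _ _ _ _ markedPt P Pi intensity_measure.
Proof.
move=> h A mA fA.
have [] := h 1%N (fun=> A) (fun=> 0%N) (fun=> mA) (fun=> fA).
  by move=> i j; rewrite !ord1.
set E := \bigcap_(i in _) _.
have -> : E = @miss _ _ _ markedPt Pi A.
  apply/seteqP; split => w; rewrite /E /miss /=.
    move=> /(_ ord0 I) /= ; rewrite /counting; case: asboolP => // finA [] /eqP.
    by rewrite pnatr_eq0 finmap.cardfs_eq0 => /eqP /fset_set_set0 ->.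
  by move=> h0 i _ /=; rewrite h0 /counting asboolT// fset_set0.
move=> mE PE; split => //; rewrite PE big_ord1 /Defs.poisson_prob/= expr0 fact0 divr1 mul1r.
by [].
Qed.
End Intensity.

Section LPPLaw.
Context (R : realType) (d : measure_display) (Omega : measurableType d)
  (P : probability Omega R) (F : probability R R) (Pi : Omega -> set (Pt R)).
Hypothesis hmiss : @miss_law _ _ _ _ (markedPt R) P Pi (intensity_measure F).
Implicit Types (p q r : R * R) (n : nat) (w : Omega).

Definition area p q : R := (q.1 - p.1) * (q.2 - p.2).

Definition below p q : bool := (p.1 < q.1) && (p.2 < q.2).

Lemma measurable_cell p q n (c : cellT n) : @measurable _ (markedPt R) (cell p q c).
Proof. by apply: measurableX; first apply: measurableX; exact: measurable_itv. Qed.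

Lemma intensity_cell p q n (c : cellT n) : below p q ->
  intensity_measure F (cell p q c) =
  ((area p q / n.+1%:R ^+ 2)%:E * F `](c.2%:R / n.+1%:R)%R, (c.2.+1%:R / n.+1%:R)%R]%classic)%E.
Proof.
move=> /andP[pq1 pq2]; rewrite intensity_box//.
- congr (_%:E * _)%E; rewrite [c.1.1.+1%:R]mulrSr [c.1.2.+1%:R]mulrSr /area.
  have : n.+1%:R != 0 :> R by rewrite pnatr_eq0.
  by move: (n.+1%:R) => N N0; field.
- by rewrite lerD2l ler_wpM2r ?ler_nat// divr_ge0// subr_ge0 ltW.
- by rewrite lerD2l ler_wpM2r ?ler_nat// divr_ge0// subr_ge0 ltW.
Qed.

Lemma intensity_cell_lty p q n (c : cellT n) : below p q ->
  (intensity_measure F (cell p q c) < +oo)%E.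
Proof.
move=> pq; rewrite intensity_cell// -ge0_fin_numE ?mule_ge0// ?lee_fin.
  by rewrite fin_numM// fin_num_measure.
by case/andP: pq => *; rewrite divr_ge0// mulr_ge0// subr_ge0 ltW.
Qed.

Lemma disjoint_itvs (a h : R) (i j : nat) : 0 < h -> i != j ->
  `]a + i%:R * h, a + i.+1%:R * h]%classic `&` `]a + j%:R * h, a + j.+1%:R * h]%classic = set0.
Proof.
move=> h0 ij; apply/seteqP; split => // x [/=]; rewrite !in_itv/= => /andP[a1 a2] /andP[b1 b2].
have : (i < j.+1)%N by rewrite -(ltr_nat R) -(ltr_pM2r h0) -(ltrD2l a); exact: lt_le_trans a1 b2.
have : (j < i.+1)%N by rewrite -(ltr_nat R) -(ltr_pM2r h0) -(ltrD2l a); exact: lt_le_trans b1 a2.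
by rewrite !ltnS => ji ij'; move: ij; rewrite eqn_leq ji ij'.
Qed.

Lemma disjoint_cells p q n (b c : cellT n) : below p q -> b != c ->
  cell p q b `&` cell p q c = set0.
Proof.
move=> /andP[pq1 pq2] bc.
have N0 : 0 < n.+1%:R :> R by rewrite ltr0n.
have dx0 : 0 < (q.1 - p.1) / n.+1%:R by rewrite divr_gt0// subr_gt0.
have dy0 : 0 < (q.2 - p.2) / n.+1%:R by rewrite divr_gt0// subr_gt0.
have {}bc : [|| b.1.1 != c.1.1, b.1.2 != c.1.2 | b.2 != c.2].
  move: b c bc => [[b1 b2] b3] [[c1 c2] c3] /=; rewrite -!pair_eqE /pair_eq/=.
  by rewrite !negb_and -orbA.
apply/seteqP; split => // z [[[z1 z2] z3] [[z4 z5] z6]].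
case/or3P : bc => ne.
- by have : (set0 : set R) z.1.1 by rewrite -(disjoint_itvs p.1 dx0 ne).
- by have : (set0 : set R) z.1.2 by rewrite -(disjoint_itvs p.2 dy0 ne).
- have Ni0 : 0 < n.+1%:R^-1 :> R by rewrite invr_gt0.
  by have : (set0 : set R) z.2 by rewrite -(disjoint_itvs 0 Ni0 ne) !add0r.
Qed.

Definition grid_pattern p q n w : {ffun cellT n -> bool} :=
  pattern (X := markedPt R) Pi (@cell R p q n) w.

Definition grid_LPP p q n w : R := grid_lpp R (grid_pattern p q n w).

Lemma grid_pattern_hit p q n w : is_hit (Pi w) p q (grid_pattern p q n w).
Proof.
move=> c; rewrite ffunE; split.
  by move/asboolP => h; apply/set0P/negP => /eqP e; apply: h; exact: e.
by move=> h; apply/asboolP => e; case: h => x; rewrite e.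
Qed.

Lemma bounded_grid_LPP p q n (h : R -> R) : below p q ->
  bounded_rv (fun w => h (grid_LPP p q n w)).
Proof.
move=> pq; apply: (proj1 (expect_pattern hmiss _ _ _ (fun b => h (grid_lpp R b)))).
- exact: measurable_cell.
- by move=> c; exact: intensity_cell_lty.
- by move=> b c; exact: disjoint_cells.
Qed.

(** The intensity of a cell involves the box only through its area, hence the patterns on the two
    grids have the same law. *)
Lemma expect_grid_LPP_area p q p' q' n (h : R -> R) :
  below p q -> below p' q' -> area p q = area p' q' ->
  Ex P (fun w => h (grid_LPP p q n w)) = Ex P (fun w => h (grid_LPP p' q' n w)).
Proof.
move=> pq pq' e.
have E u v (uv : below u v) : Ex P (fun w => h (grid_LPP u v n w)) =
    \sum_b h (grid_lpp R b) *
      pattern_prob (fun c => fine (intensity_measure F (@cell R u v n c))) b.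
  exact: (proj2 (expect_pattern hmiss (@measurable_cell u v n)
    (fun c => intensity_cell_lty c uv) (fun b c => @disjoint_cells u v n b c uv)
    (fun b => h (grid_lpp R b)))).
have mE : (fun c => fine (intensity_measure F (@cell R p q n c))) =
  (fun c => fine (intensity_measure F (@cell R p' q' n c))).
  by apply/funext => c; rewrite (intensity_cell c pq) (intensity_cell c pq') e.
by rewrite (E _ _ pq) (E _ _ pq') mE.
Qed.

(** The columns of the first grid stop at [q.1], where those of the second start, so the two
    families of cells are disjoint. *)
Lemma expect_grid_LPP_indep p q r n (h k : R -> R) : below p q -> below q r ->
  Ex P (fun w => h (grid_LPP p q n w) * k (grid_LPP q r n w)) =
  Ex P (fun w => h (grid_LPP p q n w)) * Ex P (fun w => k (grid_LPP q r n w)).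
Proof.
move=> pq qr.
apply: (expect_pattern_indep hmiss (fun b => h (grid_lpp R b)) (fun b => k (grid_lpp R b))
  (@measurable_cell p q n)
  (fun c => intensity_cell_lty c pq) (fun b c => @disjoint_cells p q n b c pq)
  (@measurable_cell q r n)
  (fun c => intensity_cell_lty c qr) (fun b c => @disjoint_cells q r n b c qr)).
case/andP: pq => pq _; case/andP: qr => qr _.
move=> b c; apply/seteqP; split => // z [/cellP[/andP[_ a] _ _] /cellP[/andP[b' _] _ _]].
move: b'; rewrite ltNge => /negP; apply; apply: (le_trans a).
rewrite (@le_trans _ _ q.1)//; last by rewrite lerDl mulr_ge0// divr_ge0// subr_ge0 ltW.
rewrite -lerBrDl mulrCA ler_piMr ?subr_ge0 ?(ltW pq)//.
by rewrite ler_pdivrMr// mul1r ler_nat.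
Qed.

End LPPLaw.

Lemma cvg_seq_unique (R : realType) (u : nat -> R) (a b : R) :
  u n @[n --> \oo] --> a -> u n @[n --> \oo] --> b -> a = b.
Proof. by move=> A B; rewrite -(cvg_lim _ A)// -(cvg_lim _ B). Qed.

(** * The passage time as a limit of grid values *)

Section LPPLimit.
Context (R : realType) (d : measure_display) (Omega : measurableType d)
  (P : probability Omega R) (F : probability R R) (Pi : Omega -> set (Pt R)).
Hypothesis hmiss : @miss_law _ _ _ _ (markedPt R) P Pi (intensity_measure F).
Implicit Types (p q r : R * R) (n : nat) (w : Omega).

Lemma chain_sums0 (C : set (Pt R)) p q : chain_sums C p q 0.
Proof. by exists [::]; rewrite ?big_nil. Qed.

Lemma grid_LPP_le p q n w M : below p q -> ubound (chain_sums (Pi w) p q) M ->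
  grid_LPP Pi p q n w <= M.
Proof.
move=> /andP[pq1 pq2] hM; apply: ge_sup.
  by case: (has_sup_grid_sums R (grid_pattern Pi p q n w)).
move=> _ [s [ss bs] <-].
have [s' cs' /le_trans] := chain_of_grid pq1 pq2 (grid_pattern_hit Pi p q (n:=n) w) ss bs.
by apply; apply: hM; exists s'.
Qed.

Lemma chain_sum_le_grid p q w y (e : R) : below p q -> chain_sums (Pi w) p q y -> 0 < e ->
  \forall n \near \oo, y <= grid_LPP Pi p q n w + e.
Proof.
move=> /andP[pq1 pq2] [s cs <-] e0.
have cs' := chain_filter (fun z => 0 < z.2) cs.
have s0 z : z \in [seq z <- s | 0 < z.2] -> 0 < z.2.
  by rewrite mem_filter => /andP[].
apply: filterS (grid_of_chain pq1 pq2 cs' s0 e0) => n.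
move=> /(_ _ (grid_pattern_hit Pi p q (n:=n) w))[s' [ss' bs' h]].
apply: (@le_trans _ _ (\sum_(z <- [seq z <- s | 0 < z.2]) z.2)).
  rewrite big_filter [leLHS](bigID (fun z => 0 < z.2))/= gerDl sumr_le0// => z.
  by rewrite -leNgt.
by apply: (le_trans h); rewrite lerD2r; exact: grid_lpp_ge.
Qed.

(** Rewrites finiteness as a countable condition on grid values, which makes it a measurable
    event. *)
Lemma has_ubound_chain_sums p q w : below p q ->
  has_ubound (chain_sums (Pi w) p q) <-> exists M : nat, forall n, grid_LPP Pi p q n w <= M%:R.
Proof.
move=> pq; split => [[M hM]|[M hM]].
  exists (Num.truncn M).+1 => n; apply: le_trans (grid_LPP_le n pq hM) _.
  exact/ltW/truncnS_gt.
exists M%:R => y hy; apply/ler_addgt0Pr => e e0.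
have [n _ /(_ n (leqnn _))/=] := chain_sum_le_grid pq hy e0.
by move=> /le_trans; apply; rewrite lerD2r.
Qed.

Lemma grid_LPP_cvg p q w : below p q -> has_ubound (chain_sums (Pi w) p q) ->
  grid_LPP Pi p q n w @[n --> \oo] --> LPP (Pi w) p q.
Proof.
move=> pq hub; have hs : has_sup (chain_sums (Pi w) p q).
  by split => //; exists 0; exact: chain_sums0.
have ub : ubound (chain_sums (Pi w) p q) (LPP (Pi w) p q) by exact: sup_upper_bound.
apply/cvgrPdist_le => e e0.
have e20 : 0 < e / 2 by lra.
have [y hy ye] := sup_adherent e20 hs.
apply: filterS (chain_sum_le_grid pq hy e20) => n h.
rewrite ler_norml; have := grid_LPP_le n pq ub.
by move: ye; rewrite -LPP_chain_sums => *; apply/andP; split; lra.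
Qed.

(** The default value of [sup], which [LPP] takes outside [lpp_bounded]. *)
Lemma LPP_unbounded p q w : ~ has_ubound (chain_sums (Pi w) p q) ->
  LPP (Pi w) p q = 0.
Proof. by move=> h; rewrite LPP_chain_sums sup_out// => -[]. Qed.

Definition lpp_bounded p q : set Omega := [set w | has_ubound (chain_sums (Pi w) p q)].

Lemma measurable_grid_LPP p q n : below p q -> measurable_fun setT (grid_LPP Pi p q n).
Proof. by move=> pq; case: (bounded_grid_LPP hmiss n id pq). Qed.

Lemma measurable_lpp_bounded p q : below p q -> measurable (lpp_bounded p q).
Proof.
move=> pq.
have -> : lpp_bounded p q = \bigcup_M \bigcap_n [set w | grid_LPP Pi p q n w <= M%:R].
  apply/seteqP; split => w.
    by move=> /(has_ubound_chain_sums w pq)[M hM]; exists M => // n _; exact: hM.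
  by move=> [M _ hM]; apply/(has_ubound_chain_sums w pq); exists M => n; exact: hM.
apply: bigcupT_measurable => M; apply: bigcapT_measurable => n.
rewrite -[X in measurable X]setTI; apply: measurable_fun_le => //.
exact: measurable_grid_LPP.
Qed.

Lemma measurable_LPP p q : below p q -> measurable_fun setT (fun w => LPP (Pi w) p q).
Proof.
move=> pq; have mB := measurable_lpp_bounded pq.
(* The indicator makes the grid values converge at every sample point, including those where [LPP]
   has its default value 0. *)
apply: (@measurable_fun_cvg _ _ _ setT
  (fun n w => grid_LPP Pi p q n w * \1_(lpp_bounded p q) w)).
  move=> n; apply: measurable_funM; first exact: measurable_grid_LPP.
  exact: measurable_indic.
move=> w _; have [wB|wB] := pselect (lpp_bounded p q w).
  under eq_fun do rewrite indicE mem_set// mulr1.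
  exact: grid_LPP_cvg.
under eq_fun do rewrite indicE memNset// mulr0.
by rewrite LPP_unbounded//; exact: cvg_cst.
Qed.

Lemma LPP_ge0 (C : set (Pt R)) p q : 0 <= LPP C p q.
Proof.
rewrite LPP_chain_sums; have [h|h] := pselect (has_sup (chain_sums C p q)).
  by apply: sup_upper_bound => //; exact: chain_sums0.
by rewrite sup_out.
Qed.

Section AeBounded.
Hypothesis ae_bdd : forall p q, below p q -> {ae P, forall w, lpp_bounded p q w}.

(** The functions for which dominated convergence passes from grid values to [LPP]. Boundedness is
    asked on the half line where passage times live; the truncated defect is unbounded on the other
    side. *)
Definition test_fun (h : R -> R) := continuous h /\ exists M, forall y, 0 <= y -> `|h y| <= M.

Lemma bounded_LPP h p q : test_fun h -> below p q ->
  bounded_rv (fun w => h (LPP (Pi w) p q)).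
Proof.
move=> [ch [M hM]] pq; split.
  apply: measurableT_comp; last exact: measurable_LPP.
  exact: continuous_measurable_fun.
by exists M => w; apply: hM; exact: LPP_ge0.
Qed.

Lemma expect_LPP_cvg h p q : test_fun h -> below p q ->
  Ex P (fun w => h (grid_LPP Pi p q n w)) @[n --> \oo] --> Ex P (fun w => h (LPP (Pi w) p q)).
Proof.
move=> th pq; have [ch [M hM]] := th.
apply: (@Ex_cvg _ _ _ _ _ _ M).
- by move=> n; case: (bounded_grid_LPP hmiss n h pq).
- by case: (bounded_LPP th pq).
- by move=> n w; apply: hM; exact: grid_lpp_ge0.
- apply: filterS (ae_bdd pq) => w wB; apply: continuous_cvg; first exact: ch.
  exact: grid_LPP_cvg.
Qed.

Lemma expect_LPP_area h p q p' q' : test_fun h -> below p q -> below p' q' ->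
  area p q = area p' q' ->
  Ex P (fun w => h (LPP (Pi w) p q)) = Ex P (fun w => h (LPP (Pi w) p' q')).
Proof.
move=> th pq pq' e; have A := expect_LPP_cvg th pq; have B := expect_LPP_cvg th pq'.
have E : (fun n => Ex P (fun w => h (grid_LPP Pi p q n w))) =
    (fun n => Ex P (fun w => h (grid_LPP Pi p' q' n w))).
  by apply/funext => n; exact: (expect_grid_LPP_area hmiss n h pq pq' e).
by rewrite E in A; exact: cvg_seq_unique A B.
Qed.

Lemma expect_LPP_indep h k p q r : test_fun h -> test_fun k -> below p q -> below q r ->
  Ex P (fun w => h (LPP (Pi w) p q) * k (LPP (Pi w) q r)) =
  Ex P (fun w => h (LPP (Pi w) p q)) * Ex P (fun w => k (LPP (Pi w) q r)).
Proof.
move=> th tk pq qr; have [ch [M hM]] := th; have [ck [N hN]] := tk.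
have A := cvgM (expect_LPP_cvg th pq) (expect_LPP_cvg tk qr).
have E : (fun n => Ex P (fun w => h (grid_LPP Pi p q n w)) * Ex P (fun w => k (grid_LPP Pi q r n w))) =
    (fun n => Ex P (fun w => h (grid_LPP Pi p q n w) * k (grid_LPP Pi q r n w))).
  by apply/funext => n; symmetry; exact: (expect_grid_LPP_indep hmiss n h k pq qr).
suff B : Ex P (fun w => h (grid_LPP Pi p q n w) * k (grid_LPP Pi q r n w)) @[n --> \oo]
    --> Ex P (fun w => h (LPP (Pi w) p q) * k (LPP (Pi w) q r)).
  by apply: cvg_seq_unique B _; rewrite -E; exact: A.
apply: (@Ex_cvg _ _ _ _ _ _ (M * N)).
- move=> n; apply: measurable_funM; first by case: (bounded_grid_LPP hmiss n h pq).
  by case: (bounded_grid_LPP hmiss n k qr).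
- apply: measurable_funM; first by case: (bounded_LPP th pq).
  by case: (bounded_LPP tk qr).
- move=> n w; rewrite normrM; apply: ler_pM => //; first by apply: hM; exact: grid_lpp_ge0.
  by apply: hN; exact: grid_lpp_ge0.
- apply: filterS2 (ae_bdd pq) (ae_bdd qr) => w w1 w2.
  apply: cvgM; (apply: continuous_cvg; [exact: ch || exact: ck|exact: grid_LPP_cvg]).
Qed.

End AeBounded.
End LPPLimit.

(** * Exponential tail *)

Lemma ler_lim_le (R : realType) (u : nat -> R) (l M : R) :
  u n @[n --> \oo] --> l -> (forall n, u n <= M) -> l <= M.
Proof.
move=> cu h; rewrite -(cvg_lim _ cu)//; apply: limr_le.
  by apply/cvg_ex; exists l.
exact: nearW.
Qed.

Lemma measurable_gt_set (R : realType) (d : measure_display) (T : measurableType d)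
  (f : T -> R) (y : R) : measurable_fun setT f -> measurable [set w | y < f w].
Proof.
move=> mf; rewrite (_ : [set w | y < f w] = ~` ([set: T] `&` [set w | f w <= y])).
  by apply: measurableC; apply: measurable_fun_le.
rewrite setTI; apply/seteqP; split => w /=; rewrite ltNge => /negP//.
Qed.

Section ExpSums.
Context (R : realType).

Lemma exp_partial_sum (x : R) n : 0 <= x -> \sum_(l < n) x ^+ l / l`!%:R <= expR x.
Proof.
move=> x0; rewrite /expR -(big_mkord xpredT (fun l => x ^+ l / l`!%:R)).
apply: (@nondecreasing_cvgn_le _ (series (exp_coeff x))).
  by apply: nondecreasing_series => k _ _; exact: exp_coeff_ge0.
exact: is_cvg_series_exp_coeff.
Qed.

Lemma sum_sqr_le (n : nat) (u : 'I_n -> R) : (forall i, 0 <= u i) ->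
  \sum_i u i ^+ 2 <= (\sum_i u i) ^+ 2.
Proof.
move=> u0; rewrite expr2 big_distrl/= ler_sum// => i _.
rewrite expr2 ler_wpM2l// [leRHS](bigD1 i)//= lerDl sumr_ge0//.
Qed.

Lemma bin_fact_le (N l : nat) : ('C(N, l) * l`! <= N ^ l)%N.
Proof.
rewrite bin_ffact; elim: l N => [|l IH] N; first by rewrite ffactn0 expn0.
rewrite ffactnS expnS leq_mul2l (leq_trans (IH _)) ?orbT//.
by case: l {IH} => [//|l]; rewrite leq_exp2r// leq_pred.
Qed.

(** The squared binomial counts pairs of increasing index sequences of length [l]. With
    [s = sqrt x], the bound ['C(N.+1, l) * l! <= N.+1 ^ l] reduces the sum to that of
    [(s ^ l / l!) ^ 2], at most the square of the exponential sum. This is where the square root of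
    the area comes from. *)
Lemma chain_count_le (N : nat) (x : R) : 0 <= x ->
  \sum_(l < N.+2) 'C(N.+1, l)%:R ^+ 2 * (x / N.+1%:R ^+ 2) ^+ l <= expR (2 * Num.sqrt x).
Proof.
move=> x0; set s := Num.sqrt x.
have s0 : 0 <= s by exact: sqrtr_ge0.
have xs : x = s ^+ 2 by rewrite sqr_sqrtr.
apply: (@le_trans _ _ ((\sum_(l < N.+2) s ^+ l / l`!%:R) ^+ 2)); last first.
  rewrite [2 * s]mulrC -[leRHS]/(expR (s * 2%:R)) expRM_natr.
  have h : 0 <= \sum_(l < N.+2) s ^+ l / l`!%:R.
    by apply: sumr_ge0 => i _; rewrite divr_ge0// exprn_ge0.
  by rewrite ler_pXn2r ?nnegrE ?expR_ge0//; exact: exp_partial_sum.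
apply: le_trans; last first.
  by apply: sum_sqr_le => i; rewrite divr_ge0// exprn_ge0.
apply: ler_sum => l _.
have f0 : 0 < l`!%:R :> R by rewrite ltr0n fact_gt0.
have N0 : 0 < N.+1%:R :> R by rewrite ltr0n.
rewrite xs -expr_div_n -exprM mulnC exprM -exprMn ler_pXn2r ?nnegrE//.
- have h : 'C(N.+1, l)%:R * l`!%:R <= N.+1%:R ^+ l :> R.
    by rewrite -natrX -natrM ler_nat; exact: bin_fact_le.
  have E (x1 x2 x3 x4 : R) : x1 * (x2 / x3) * x4 = x1 * x4 / x3 * x2 by ring.
  rewrite expr_div_n ler_pdivlMr// E ler_piMl ?exprn_ge0//.
  by rewrite ler_pdivrMr ?exprn_gt0// mul1r.
- by rewrite mulr_ge0// exprn_ge0// divr_ge0.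
- by rewrite divr_ge0// exprn_ge0.
Qed.

End ExpSums.

Section WeightLevels.
Context (R : realType) (F : probability R R) (a : R).
Hypotheses (a0 : 0 < a) (ea : (\int[F]_x (expR (a * x))%:E < +oo)%E).

Definition exp_moment : R := fine (\int[F]_x (expR (a * x))%:E).

Lemma exp_moment_ge0 : 0 <= exp_moment.
Proof. by rewrite fine_ge0// integral_ge0// => x _; rewrite lee_fin expR_ge0. Qed.

(** The left side is the integral of the step function equal to [expR (a * k / n.+1)] on the level
    [k], which lies below [expR (a * x)]. *)
Lemma sum_level_le (n K : nat) :
  \sum_(k < K) fine (F `]k%:R / n.+1%:R, k.+1%:R / n.+1%:R]%classic) *
     expR (a * (k%:R / n.+1%:R)) <= exp_moment.
Proof.
pose I (k : nat) := `]k%:R / n.+1%:R, k.+1%:R / n.+1%:R]%classic : set R.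
have N0 : 0 < n.+1%:R^-1 :> R by rewrite invr_gt0 ltr0n.
have mI k : measurable (I k) by exact: measurable_itv.
have bI (k : 'I_K) : bounded_rv (fun x : R => expR (a * (k%:R / n.+1%:R)) * \1_(I k) x).
  by apply: bounded_rvZ; exact: bounded_rv_indic.
have -> : \sum_(k < K) fine (F (I k)) * expR (a * (k%:R / n.+1%:R)) =
    Ex F (fun x => \sum_(k < K) expR (a * (k%:R / n.+1%:R)) * \1_(I k) x).
  rewrite Ex_sum//; apply: eq_bigr => k _.
  by rewrite ExZ ?Ex_indic 1?mulrC//; exact: bounded_rv_indic.
rewrite -lee_fin -EFin_Ex; last exact: bounded_rv_sum.
rewrite /exp_moment fineK; last first.
  by rewrite ge0_fin_numE// integral_ge0// => x _; rewrite lee_fin expR_ge0.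
apply: ge0_le_integral => //.
- move=> x _; rewrite lee_fin; apply: sumr_ge0 => k _.
  by apply: mulr_ge0; [exact: expR_ge0|rewrite indicE].
- by apply/measurable_EFinP; case: (bounded_rv_sum (index_enum 'I_K) bI).
- apply/measurable_EFinP; apply: measurableT_comp; first exact: measurable_expR.
  by apply: mulrl_measurable.
move=> x _; rewrite lee_fin.
have [[k /= kK hk]|nk] := pselect (exists2 k, (k < K)%N & I k x).
  rewrite (bigD1 (Ordinal kK))//= big1 ?addr0.
    rewrite indicE mem_set// mulr1 ler_expR ler_pM2l//.
    by move: hk; rewrite /I /= in_itv/= => /andP[/ltW].
  move=> j jk; rewrite indicE memNset ?mulr0// => hj.
  have jk' : (j : nat) != k by apply: contraNneq jk => e; apply/eqP/val_inj.
  have : (set0 : set R) x.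
    rewrite -(disjoint_itvs 0 N0 jk') !add0r; split => //.
  by [].
rewrite big1 ?expR_ge0// => k _; rewrite indicE memNset ?mulr0// => h.
by apply: nk; exists k.
Qed.

End WeightLevels.


Section Tail.
Context (R : realType) (d : measure_display) (Omega : measurableType d)
  (P : probability Omega R) (F : probability R R) (Pi : Omega -> set (Pt R)) (a : R).
Hypothesis hmiss : @miss_law _ _ _ _ (markedPt R) P Pi (intensity_measure F).
Hypotheses (a0 : 0 < a) (ea : (\int[F]_x (expR (a * x))%:E < +oo)%E).
Variables (p q : R * R) (n : nat).
Hypothesis pq : below p q.

Let N := n.+1.

(** A chain of cells split into its two index sequences and a free choice [f] of levels, so that
    sums over the levels factor. *)
Definition mk_chain l (ti tj : l.-tuple 'I_n.+1) (f : {ffun 'I_l -> 'I_(n.+1 * n.+1)}) :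
  seq (cellT n) := [seq (tnth ti i, tnth tj i, f i) | i <- enum 'I_l].

Let hits (s : seq (cellT n)) : set Omega :=
  hit_all (X := markedPt R) Pi (@cell R p q n) s.

(** Distinct cells are hit independently, each with probability [1 - expR (- m) <= m]; the void set
    in the joint law is taken empty. *)
Lemma prob_hit_all_le s : uniq s ->
  Ex P \1_(hits s) <= \prod_(c <- s) fine (intensity_measure F (cell p q c)).
Proof.
move=> us.
have mh : measurable (hits s).
  apply: (measurable_hit_all hmiss) => c _; first exact: measurable_cell.
  exact: intensity_cell_lty.
rewrite Ex_indic//.
have : P (miss (X := markedPt R) Pi set0 `&` hits s) = (expR (- fine (intensity_measure F set0)) *
   \prod_(c <- s) (1 - expR (- fine (intensity_measure F (cell p q c)))))%:E.
  apply: (prob_miss_hit_all hmiss) => //.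
  - by move=> c _; exact: measurable_cell.
  - by move=> c _; exact: intensity_cell_lty.
  - by move=> b c _ _; exact: disjoint_cells.
  - by rewrite measure0.
  - by move=> c _; rewrite set0I.
rewrite measure0 /= oppr0 expR0 mul1r.
rewrite (_ : miss (X := markedPt R) Pi set0 = setT); last first.
  by apply/seteqP; split => // w _; rewrite /miss /= setI0.
rewrite setTI => ->/=.
apply: ler_prod => c _; apply/andP; split.
  by rewrite subr_ge0 expR_le1 oppr_le0 fine_ge0.
by have := expR_ge1Dx (- fine (intensity_measure F (cell p q c))); lra.
Qed.

Let term l (t : l.-tuple 'I_n.+1 * l.-tuple 'I_n.+1) f (w : Omega) : R :=
  expR (a * \sum_(c <- mk_chain t.1 t.2 f) cell_weight R c) * \1_(hits (mk_chain t.1 t.2 f)) w.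

Let good l (t : l.-tuple 'I_n.+1 * l.-tuple 'I_n.+1) :=
  sorted ltn (map val t.1) && sorted ltn (map val t.2).

(** The partition function of all fully hit chains of cells, each weighted by the exponential of [a]
    times its weight. Strictly increasing index sequences have at most [n.+1] entries, whence the
    range of [l]. *)
Let total (w : Omega) : R := \sum_(l < N.+1)
  \sum_(t <- [seq t <- index_enum (l.-tuple 'I_n.+1 * l.-tuple 'I_n.+1)%type | good t])
  \sum_(f : {ffun 'I_l -> 'I_(n.+1 * n.+1)}) term t f w.

Let bounded_term l t f : bounded_rv (@term l t f).
Proof.
apply: bounded_rvZ; apply: bounded_rv_indic.
apply: (measurable_hit_all hmiss) => c _; first exact: measurable_cell.
exact: intensity_cell_lty.
Qed.

Let bounded_total : bounded_rv total.
Proof. by do 3! apply: bounded_rv_sum => ?; exact: bounded_term. Qed.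

Lemma uniq_mk_chain l (t : l.-tuple 'I_n.+1 * l.-tuple 'I_n.+1) f :
  good t -> uniq (mk_chain t.1 t.2 f).
Proof.
move=> /andP[s1 _]; rewrite map_inj_uniq ?enum_uniq// => i j [e _ _].
have ut : uniq t.1 by rewrite -(map_inj_uniq val_inj); exact: sorted_uniq ltn_trans ltnn _ s1.
exact: (tuple_uniqP _ ut).
Qed.

(** For fixed index sequences, the sum over the levels is by distributivity the [l]-th power of a
    single sum, at most [area p q * exp_moment F a / n.+1 ^ 2]. Counting the sequences leaves the
    sum of [chain_count_le]. *)
Lemma expect_total : Ex P total <= expR (2 * Num.sqrt (area p q * exp_moment F a)).
Proof.
have A0 : 0 <= area p q.
  by case/andP: pq => *; rewrite mulr_ge0// subr_ge0 ltW.
have m0 := exp_moment_ge0 F a.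
rewrite /total Ex_sum; last first.
  by move=> l; do 2! apply: bounded_rv_sum => ?; exact: bounded_term.
apply: le_trans (chain_count_le n (mulr_ge0 A0 m0)).
apply: ler_sum => l _; rewrite Ex_sum; last first.
  by move=> t; apply: bounded_rv_sum => ?; exact: bounded_term.
pose x := area p q * exp_moment F a / n.+1%:R ^+ 2.
apply: (@le_trans _ _ (\sum_(t <- [seq t <- index_enum (l.-tuple 'I_n.+1 * l.-tuple 'I_n.+1)%type | good t]) x ^+ l)).
  apply: ler_sum_in => t; rewrite mem_filter => /andP[gt _].
  rewrite Ex_sum; last by move=> f; exact: bounded_term.
  pose G (k : 'I_(n.+1 * n.+1)) := (area p q / n.+1%:R ^+ 2) *
    (fine (F `]k%:R / n.+1%:R, k.+1%:R / n.+1%:R]%classic) * expR (a * (k%:R / n.+1%:R))).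
  have c0 : 0 <= area p q / n.+1%:R ^+ 2 by rewrite divr_ge0// exprn_ge0.
  have G0 k : 0 <= G k.
    by apply: mulr_ge0 => //; apply: mulr_ge0; [exact: fine_ge0|exact: expR_ge0].
  apply: (@le_trans _ _ (\sum_(f : {ffun 'I_l -> 'I_(n.+1 * n.+1)}) \prod_i G (f i))).
    apply: ler_sum => f _; rewrite ExZ; last first.
      apply: bounded_rv_indic.
      apply: (measurable_hit_all hmiss) => c _; first exact: measurable_cell.
      exact: intensity_cell_lty.
    apply: (@le_trans _ _ (expR (a * \sum_(c <- mk_chain t.1 t.2 f) cell_weight R c) *
      \prod_(c <- mk_chain t.1 t.2 f) fine (intensity_measure F (cell p q c)))).
      by rewrite ler_wpM2l ?expR_ge0//; apply: prob_hit_all_le; exact: uniq_mk_chain.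
    rewrite mulr_sumr expR_sum -big_split/= big_map big_enum/=.
    apply: ler_prod => i _; rewrite intensity_cell// fineM// ?fin_num_measure//=.
    apply/andP; split.
      apply: mulr_ge0; first exact: expR_ge0.
      by apply: mulr_ge0 => //; exact: fine_ge0.
    have E (x1 x2 x3 : R) : x1 * (x2 * x3) = x2 * (x3 * x1) by ring.
    by rewrite E.
  rewrite -(bigA_distr_bigA (fun=> G)) prodr_const card_ord.
  apply: lerXn2r; rewrite ?nnegrE; first exact: sumr_ge0.
    by rewrite divr_ge0 ?exprn_ge0// mulr_ge0.
  have -> : x = area p q / n.+1%:R ^+ 2 * exp_moment F a by rewrite /x mulrAC.
  rewrite -mulr_sumr; apply: ler_wpM2l => //.
  exact: sum_level_le.
rewrite big_const_seq count_filter iter_addr_0 -[leLHS]mulr_natl -/x ler_wpM2r//.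
  by rewrite exprn_ge0// divr_ge0 ?exprn_ge0// mulr_ge0.
rewrite -natrX ler_nat.
have -> : count (predI xpredT (@good l)) (index_enum (l.-tuple 'I_n.+1 * l.-tuple 'I_n.+1)%type) =
  #|[pred t | @good l t]|.
  by rewrite cardE -size_filter /enum_mem; congr size; rewrite unlock; apply: eq_filter.
rewrite expnS expn1 -!card_ltn_sorted_tuples -cardsX subset_leq_card//.
by apply/fintype.subsetP => t; rewrite !inE.
Qed.

(** A chain of weight above [y] is one of the terms of [total], and the other terms are
    nonnegative. *)
Lemma hit_grid_le_total w y : y < grid_LPP Pi p q n w ->
  expR (a * y) <= total w.
Proof.
move=> hy; have [_ [s [ss bs] <-] sy] : exists2 x : R, grid_sums (grid_pattern Pi p q n w) x & y < x.
  apply: contrapT => h; move: hy; rewrite ltNge => /negP; apply.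
  apply: ge_sup; first by case: (has_sup_grid_sums R (grid_pattern Pi p q n w)).
  by move=> x hx; rewrite leNgt; apply/negP => yx; apply: h; exists x.
have s1 : sorted ltn (map val [seq c.1.1 | c <- s]).
  by rewrite -map_comp; apply: homo_sorted ss => x x' /andP[].
have s2 : sorted ltn (map val [seq c.1.2 | c <- s]).
  by rewrite -map_comp; apply: homo_sorted ss => x x' /andP[].
have hl : (size s < N.+1)%N.
  have u1 : uniq [seq c.1.1 | c <- s].
    by rewrite -(map_inj_uniq val_inj); exact: sorted_uniq ltn_trans ltnn _ s1.
  have := max_card (mem [seq c.1.1 | c <- s]).
  by rewrite (card_uniqP u1) size_map card_ord.
pose l := Ordinal hl.
pose t : l.-tuple 'I_n.+1 * l.-tuple 'I_n.+1 :=
  (map_tuple (fun c => c.1.1) (in_tuple s), map_tuple (fun c => c.1.2) (in_tuple s)).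
pose f : {ffun 'I_l -> 'I_(n.+1 * n.+1)} := [ffun i => (tnth (in_tuple s) i).2].
have chE : mk_chain t.1 t.2 f = s.
  rewrite /mk_chain -[RHS](map_tnth_enum (in_tuple s)); apply: eq_map => i.
  by rewrite !tnth_map ffunE; case: (tnth _ _) => [[]].
have term0 l' t' f' w' : 0 <= @term l' t' f' w'.
  by apply: mulr_ge0; [exact: expR_ge0|rewrite indicE].
apply: (@le_trans _ _ (term t f w)).
  rewrite /term chE indicE mem_set ?mulr1 ?ler_expR ?ler_pM2l ?ltW//.
  move=> c cs; have := allP bs _ cs; rewrite ffunE => /asboolP; exact.
rewrite /total (bigD1 l)//= -[leLHS]addr0; apply: lerD; last first.
  by apply: sumr_ge0 => ? _; do 2! apply: sumr_ge0 => ? _.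
rewrite (bigD1_seq t)/= ?filter_uniq ?index_enum_uniq//; last first.
  by rewrite mem_filter mem_index_enum andbT /good s1 s2.
rewrite -[leLHS]addr0; apply: lerD; last first.
  by do 2! apply: sumr_ge0 => ? _.
by rewrite (bigD1 f)//= lerDl; apply: sumr_ge0 => ? _.
Qed.

(** Markov's inequality for [total]. The bound is uniform in [n], so it survives refinement of the
    grid. *)
Lemma prob_grid_LPP_gt (y : R) :
  Ex P \1_[set w | y < grid_LPP Pi p q n w] <=
  expR (2 * Num.sqrt (area p q * exp_moment F a) - a * y).
Proof.
have mG : measurable [set w | y < grid_LPP Pi p q n w].
  by apply: measurable_gt_set; exact: (measurable_grid_LPP hmiss).
have bG := bounded_rv_indic R mG.
rewrite expRD; apply: le_trans (ler_wpM2r (expR_ge0 _) expect_total).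
rewrite mulrC -ExZ//; apply: Ex_le => //; first exact: bounded_rvZ.
move=> w; rewrite indicE; case: (boolP (w \in _)) => [/set_mem/= hw|_] /=.
  by rewrite expRN mulrC ler_pdivlMr ?expR_gt0// mul1r; exact: hit_grid_le_total hw.
apply: mulr_ge0; first exact: expR_ge0.
by rewrite /total; do 3! apply: sumr_ge0 => ? _; apply: mulr_ge0; [exact: expR_ge0|rewrite indicE].
Qed.

End Tail.

(** * Almost sure finiteness of the passage time *)

Section Tightness.
Context (R : realType) (d : measure_display) (Omega : measurableType d)
  (P : probability Omega R) (F : probability R R) (Pi : Omega -> set (Pt R)) (a : R).
Hypothesis hmiss : @miss_law _ _ _ _ (markedPt R) P Pi (intensity_measure F).
Hypotheses (a0 : 0 < a) (ea : (\int[F]_x (expR (a * x))%:E < +oo)%E).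

(** Where chain sums are unbounded, the grid values eventually exceed every level [y], so this event
    has probability below the tail bound for all [y]. *)
Lemma ae_lpp_bounded p q : below p q -> {ae P, forall w, lpp_bounded Pi p q w}.
Proof.
move=> pq; have mB := measurable_lpp_bounded hmiss pq.
have mU : measurable (~` lpp_bounded Pi p q) by exact: measurableC.
exists (~` lpp_bounded Pi p q); split => //.
have bU := bounded_rv_indic R mU.
have PE : P (~` lpp_bounded Pi p q) = (Ex P \1_(~` lpp_bounded Pi p q))%:E.
  by rewrite Ex_indic// fineK// fin_num_measure.
rewrite PE; congr EFin; apply/eqP; rewrite eq_le Ex_ge0 ?andbT; last first.
  by move=> w; rewrite indicE.
set m := 2 * Num.sqrt (area p q * exp_moment F a).
have step y : Ex P \1_(~` lpp_bounded Pi p q) <= expR (m - a * y).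
  pose G n := [set w | y < grid_LPP Pi p q n w].
  have mG n : measurable (G n).
    by apply: measurable_gt_set; exact: (measurable_grid_LPP hmiss).
  have bG n := bounded_rv_indic R (mG n).
  have cv : Ex P (fun w => \1_(~` lpp_bounded Pi p q) w * \1_(G n) w) @[n --> \oo]
      --> Ex P \1_(~` lpp_bounded Pi p q).
    apply: (@Ex_cvg _ _ _ _ _ _ 1).
    - by move=> n; case: (bounded_rvM bU (bG n)).
    - by case: bU.
    - by move=> n w; rewrite !indicE; do 2 case: (_ \in _); rewrite /= ?mulr0 ?mulr1 ?normr0 ?normr1.
    apply: aeW => w /=; rewrite indicE; case: (boolP (w \in _)) => [/set_mem/= uw|_]; last first.
      by under eq_fun do rewrite mul0r; exact: cvg_cst.
    under eq_fun do rewrite mul1r.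
    (* The margin 1 absorbs the grid error allowed by [chain_sum_le_grid]. *)
    have [x cx yx] : exists2 x, chain_sums (Pi w) p q x & y + 1 < x.
      apply: contrapT => h; apply: uw; exists (y + 1) => x cx.
      by rewrite leNgt; apply/negP => yx; apply: h; exists x.
    apply: cvg_near_cst; apply: filterS (chain_sum_le_grid pq cx ltr01) => n hn.
    by rewrite indicE mem_set// /G/=; lra.
  apply: (ler_lim_le cv) => n.
  apply: le_trans (prob_grid_LPP_gt hmiss a0 ea n pq y).
  apply: Ex_le; [exact: bounded_rvM|exact: bG|move=> w].
  by rewrite !indicE; do 2 case: (_ \in _); rewrite /= ?mulr0 ?mulr1 ?mul0r.
apply/ler_addgt0Pr => e e0; rewrite add0r.
(* The level at which the tail bound equals [e]. *)
apply: (le_trans (step ((m - ln e) / a))).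
by rewrite mulrC divfK ?gt_eqF// opprB addrC subrK lnK.
Qed.

End Tightness.

(** * Superadditivity and the truncated defect *)

Section ChainOrder.
Context (R : realType).
Implicit Types (p q r : R * R) (C : set (Pt R)).

Lemma chain_sums_sub C p q p' q' :
  p'.1 <= p.1 -> p'.2 <= p.2 -> q.1 <= q'.1 -> q.2 <= q'.2 ->
  chain_sums C p q `<=` chain_sums C p' q'.
Proof.
move=> p1 p2 q1 q2 _ [s [ss hs] <-]; exists s => //; split => // z /hs[Cz [/andP[a b] /andP[c e]]].
split => //; split; apply/andP; split.
- exact: le_lt_trans p1 a.
- exact: le_trans b q1.
- exact: le_lt_trans p2 c.
- exact: le_trans e q2.
Qed.

Lemma has_ubound_sub C p q p' q' :
  p'.1 <= p.1 -> p'.2 <= p.2 -> q.1 <= q'.1 -> q.2 <= q'.2 ->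
  has_ubound (chain_sums C p' q') -> has_ubound (chain_sums C p q).
Proof. by move=> p1 p2 q1 q2 [M hM]; exists M => x /(chain_sums_sub p1 p2 q1 q2)/hM. Qed.

Lemma LPP_mono C p q p' q' :
  p'.1 <= p.1 -> p'.2 <= p.2 -> q.1 <= q'.1 -> q.2 <= q'.2 ->
  has_ubound (chain_sums C p' q') -> LPP C p q <= LPP C p' q'.
Proof.
move=> p1 p2 q1 q2 hub; rewrite !LPP_chain_sums; apply: ge_sup.
  by exists 0; exact: chain_sums0.
move=> x /(chain_sums_sub p1 p2 q1 q2) hx; exact: ub_le_sup.
Qed.

(** Chains of the two boxes concatenate, since [q] separates them in both coordinates. Boundedness
    excludes the default value 0 on the right. *)
Lemma LPP_superadditive C p q r : below p q -> below q r ->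
  has_ubound (chain_sums C p r) -> LPP C p q + LPP C q r <= LPP C p r.
Proof.
move=> /andP[pq1 pq2] /andP[qr1 qr2] hub.
have key x y : chain_sums C p q x -> chain_sums C q r y -> x + y <= LPP C p r.
  move=> [s [ss hs] <-] [s' [ss' hs'] <-]; apply: ub_le_sup => //.
  exists (s ++ s'); last by rewrite big_cat.
  split.
    rewrite (sorted_pairwise (@lt_pt_trans R)) pairwise_cat -!(sorted_pairwise (@lt_pt_trans R)) ss ss' !andbT.
    apply/allrelP => z z' /hs[_ [/andP[_ a] /andP[_ b]]] /hs'[_ [/andP[a' _] /andP[b' _]]].
    by apply/andP; split; [exact: le_lt_trans a a'|exact: le_lt_trans b b'].
  move=> z; rewrite mem_cat => /orP[/hs|/hs'] [Cz [/andP[a b] /andP[c e]]]; split => //.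
    split; apply/andP; split => //.
      exact: le_trans b (ltW qr1).
    exact: le_trans e (ltW qr2).
  split; apply/andP; split => //.
    exact: lt_trans pq1 a.
  exact: lt_trans pq2 c.
rewrite -lerBrDr [leLHS]LPP_chain_sums; apply: ge_sup.
  by exists 0; exact: chain_sums0.
move=> x hx; rewrite lerBrDr -lerBrDl [leLHS]LPP_chain_sums; apply: ge_sup.
  by exists 0; exact: chain_sums0.
by move=> y hy; rewrite lerBrDl; exact: key.
Qed.

End ChainOrder.

Section Defect.
Context (R : realType).

Definition defect (c y : R) : R := Num.max (c - y) 0.

Lemma defect_ge0 c y : 0 <= defect c y.
Proof. by rewrite /defect le_max lexx orbT. Qed.

Lemma defect_ge c y : c - y <= defect c y.
Proof. by rewrite /defect le_max lexx. Qed.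

Lemma defect_le c y : 0 <= y -> 0 <= c -> defect c y <= c.
Proof. by move=> y0 c0; rewrite /defect ge_max c0 andbT; lra. Qed.

Lemma defect_subadd c c' x x' y : x + x' <= y ->
  defect (c + c') y <= defect c x + defect c' x'.
Proof.
move=> h; rewrite {1}/defect ge_max; apply/andP; split.
  by have := defect_ge c x; have := defect_ge c' x'; lra.
by rewrite addr_ge0// defect_ge0.
Qed.

Lemma test_fun_defect c : 0 <= c -> test_fun (defect c).
Proof.
move=> c0; split.
  move=> x; apply: (@continuous_max _ _ (fun y : R => c - y) (fun=> 0)); last exact: cvg_cst.
  apply: cvgB; [exact: cvg_cst|exact: cvg_id].
by exists c => y y0; rewrite ger0_norm ?defect_ge0// defect_le.
Qed.

Lemma test_fun_sqr (h : R -> R) : test_fun h -> test_fun (fun y => h y ^+ 2).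
Proof.
move=> [ch [M hM]]; split.
  by move=> x; apply: cvgM; exact: ch.
by exists (M ^+ 2) => y y0; rewrite normrX lerXn2r ?nnegrE ?hM// (le_trans _ (hM _ y0)).
Qed.

End Defect.

(** * Moments of the truncated defect *)

Section DefectMoments.
Context (R : realType) (d : measure_display) (Omega : measurableType d)
  (P : probability Omega R) (F : probability R R) (Pi : Omega -> set (Pt R)) (a : R).
Hypothesis hmiss : @miss_law _ _ _ _ (markedPt R) P Pi (intensity_measure F).
Hypotheses (a0 : 0 < a) (ea : (\int[F]_x (expR (a * x))%:E < +oo)%E).

Let ae_bdd := ae_lpp_bounded hmiss a0 ea.

(* Unlike [C * r - LPP], its positive part is nonnegative and bounded, and it is
   still subadditive, as the Hammersley-Kesten recursion on second moments needs. *)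
Definition square_defect (C r : R) (w : Omega) := defect (C * r) (LPP (Pi w) (0, 0) (r, r)).

Definition mean_defect C r : R := Ex P (square_defect C r).

Definition mean_sqr_defect C r : R := Ex P (fun w => square_defect C r w ^+ 2).

Lemma below_square (r : R) : 0 < r -> below (0, 0) (r, r).
Proof. by rewrite /below /= => ->. Qed.

Lemma expect_box_defect C r p q : 0 <= C -> 0 < r -> below p q -> area p q = r ^+ 2 ->
  Ex P (fun w => defect (C * r) (LPP (Pi w) p q)) = mean_defect C r /\
  Ex P (fun w => defect (C * r) (LPP (Pi w) p q) ^+ 2) = mean_sqr_defect C r.
Proof.
move=> C0 r0 pq e.
have t1 : test_fun (defect (C * r)) by apply: test_fun_defect; rewrite mulr_ge0// ltW.
have e' : area p q = area (0, 0) (r, r) by rewrite e /area /= !subr0 expr2.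
split.
  exact: (expect_LPP_area hmiss ae_bdd t1 pq (below_square r0) e').
exact: (expect_LPP_area hmiss ae_bdd (test_fun_sqr t1) pq (below_square r0) e').
Qed.

Lemma bounded_defect C c p q : 0 <= C -> 0 <= c -> below p q ->
  bounded_rv (fun w => defect (C * c) (LPP (Pi w) p q)).
Proof.
move=> C0 c0 pq; apply: (bounded_LPP hmiss _ pq).
by apply: test_fun_defect; rewrite mulr_ge0.
Qed.

Lemma ae_defect_subadd C r r' : 0 < r -> 0 < r' -> {ae P, forall w,
  square_defect C (r + r') w <=
  square_defect C r w + defect (C * r') (LPP (Pi w) (r, r) (r + r', r + r'))}.
Proof.
move=> r0 r'0; have b : below (0, 0) (r + r', r + r') by apply: below_square; exact: addr_gt0.
apply: filterS (ae_bdd b) => w wb.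
rewrite /square_defect mulrDr; apply: defect_subadd; apply: LPP_superadditive => //.
  exact: below_square.
by rewrite /below /= !ltrDl r'0.
Qed.

Lemma mean_defect_subadd C r r' : 0 <= C -> 0 < r -> 0 < r' ->
  mean_defect C (r + r') <= mean_defect C r + mean_defect C r'.
Proof.
move=> C0 r0 r'0; have rr : 0 < r + r' by exact: addr_gt0.
have b : below (r, r) (r + r', r + r') by rewrite /below /= !ltrDl r'0.
have ar : area (r, r) (r + r', r + r') = r' ^+ 2 by rewrite /area /=; ring.
rewrite -(proj1 (expect_box_defect C0 r'0 b ar)).
have b1 := bounded_defect C0 (ltW r0) (below_square r0).
have b2 := bounded_defect C0 (ltW r'0) b.
rewrite -ExD//; apply: Ex_le_ae.
- exact: (bounded_defect C0 (ltW rr) (below_square rr)).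
- exact: bounded_rvD.
- exact: ae_defect_subadd.
Qed.

(** The subadditive bound is squared, which nonnegativity permits; the two halves are independent
    with the same law, so the cross term is the squared mean. *)
Lemma mean_sqr_defect_double C r : 0 <= C -> 0 < r ->
  mean_sqr_defect C (r + r) <= 2 * mean_sqr_defect C r + 2 * mean_defect C r ^+ 2.
Proof.
move=> C0 r0; have rr : 0 < r + r by exact: addr_gt0.
have b : below (r, r) (r + r, r + r) by rewrite /below /= !ltrDl r0.
have ar : area (r, r) (r + r, r + r) = r ^+ 2 by rewrite /area /=; ring.
have [e1 e2] := expect_box_defect C0 r0 b ar.
have b1 := bounded_defect C0 (ltW r0) (below_square r0).
have b2 := bounded_defect C0 (ltW r0) b.
have b3 := bounded_defect C0 (ltW rr) (below_square rr).
set X := fun w => square_defect C r w in b1.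
set Y := fun w => defect (C * r) (LPP (Pi w) (r, r) (r + r, r + r)) in b2.
have t1 : test_fun (defect (C * r)) by apply: test_fun_defect; rewrite mulr_ge0// ltW.
have exy : Ex P (fun w => X w * Y w) = mean_defect C r ^+ 2.
  apply: (etrans (expect_LPP_indep hmiss ae_bdd t1 t1 (below_square r0) b)).
  by rewrite e1 expr2.
have -> : 2 * mean_sqr_defect C r + 2 * mean_defect C r ^+ 2 =
    Ex P (fun w => (X w * X w + Y w * Y w) + 2 * (X w * Y w)).
  rewrite ExD; [|by apply: bounded_rvD; exact: bounded_rvM|by apply: bounded_rvZ; exact: bounded_rvM].
  rewrite ExD; [|exact: bounded_rvM|exact: bounded_rvM].
  rewrite ExZ; last exact: bounded_rvM.
  rewrite exy; congr (_ + _); rewrite mulr_natl mulr2n; congr (_ + _).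
  by rewrite -e2.
apply: Ex_le_ae.
- exact: (bounded_rvM b3 b3).
- by apply: bounded_rvD; [apply: bounded_rvD; exact: bounded_rvM|apply: bounded_rvZ; exact: bounded_rvM].
- apply: filterS (ae_defect_subadd C r0 r0) => w h.
  have X0 : 0 <= X w by exact: defect_ge0.
  have Y0 : 0 <= Y w by exact: defect_ge0.
  have S0 : 0 <= square_defect C (r + r) w by exact: defect_ge0.
  have h' : square_defect C (r + r) w <= X w + Y w by [].
  by nra.
Qed.

End DefectMoments.

(** * Almost sure limit *)

(** The series of squares has finite mean, hence is almost surely finite, and its terms tend to
    0. *)
Lemma ae_cvg0_summable (R : realType) (d : measure_display) (Omega : measurableType d)
  (P : probability Omega R) (Y : nat -> Omega -> R) (B : R) :
  (forall k, bounded_rv (Y k)) ->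
  (forall n, \sum_(k < n) Ex P (fun w => Y k w ^+ 2) <= B) ->
  {ae P, forall w, Y k w @[k --> \oo] --> 0}.
Proof.
move=> bY hB; pose f k w := ((Y k w ^+ 2)%:E : \bar R).
have bY2 k : bounded_rv (fun w => Y k w ^+ 2) by exact: (bounded_rvM (bY k) (bY k)).
have mf k : measurable_fun setT (f k).
  by apply/measurable_EFinP; case: (bY2 k).
have f0 k w : (0 <= f k w)%E by rewrite lee_fin sqr_ge0.
have S0 w : (0 <= \sum_(k <oo) f k w)%E by apply: nneseries_ge0 => k _ _; exact: f0.
have iS : (\int[P]_w (\sum_(k <oo) f k w) <= B%:E)%E.
  rewrite integral_nneseries//.
  apply: lime_le.
    by apply: is_cvg_nneseries => k _ _; apply: integral_ge0 => w _; exact: f0.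
  apply: nearW => n; rewrite big_mkord.
  have -> : (\sum_(k < n) \int[P]_w f k w)%E = (\sum_(k < n) Ex P (fun w => Y k w ^+ 2))%:E.
    by rewrite -sumEFin; apply: eq_bigr => k _; exact: EFin_Ex.
  by rewrite lee_fin.
have ii : P.-integrable setT (fun w => (\sum_(k <oo) f k w)%E).
  apply/integrableP; split.
    by apply: ge0_emeasurable_sum => // k w _ _; exact: f0.
  under eq_integral do rewrite gee0_abs//.
  by rewrite (le_lt_trans iS)// ltry.
apply: filterS (integrable_ae measurableT ii) => w /(_ I) fin.
have ub n : \sum_(k < n) Y k w ^+ 2 <= fine (\sum_(k <oo) f k w)%E.
  rewrite -lee_fin fineK// -sumEFin -(big_mkord xpredT (fun k => (Y k w ^+ 2)%:E)).
  by apply: nneseries_lim_ge => k _ _; exact: f0.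
have cs : cvgn (series (fun k => Y k w ^+ 2)).
  apply: nondecreasing_is_cvgn.
    by apply: nondecreasing_series => k _ _; exact: sqr_ge0.
  exists (fine (\sum_(k <oo) f k w)%E) => _ [n _ <-].
  by rewrite /series /= big_mkord.
have := cvg_series_cvg_0 cs; move/cvgrPdist_lt => h.
apply/cvgrPdist_lt => e e0.
apply: filterS (h (e ^+ 2) (exprn_gt0 2 e0)) => k.
rewrite !sub0r !normrN normrX ltr_pXn2r// nnegrE//; exact: ltW.
Qed.

Lemma cvg_near_eq (R : realType) (u v : nat -> R) (l : R) :
  (\forall k \near \oo, u k = v k) -> u k @[k --> \oo] --> l -> v k @[k --> \oo] --> l.
Proof.
move=> uv /cvgrPdist_lt h; apply/cvgrPdist_lt => e e0.
by apply: filterS2 uv (h e e0) => k ->.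
Qed.

(** The squares of [a] telescope and half of each [u k] is left over to be summed. It is applied
    with [u] the normalised variance and [a] the normalised mean along dyadic scales. *)
Lemma sum_recursion_le (R : realType) (u a : nat -> R) :
  (forall k, 0 <= u k) -> (forall k, u k.+1 + a k.+1 ^+ 2 <= u k / 2 + a k ^+ 2) ->
  forall n, \sum_(k < n) u k <= 2 * (u 0%N + a 0%N ^+ 2).
Proof.
move=> u0 h n.
suff : u n + a n ^+ 2 + (\sum_(k < n) u k) / 2 <= u 0%N + a 0%N ^+ 2.
  by have := u0 n; have := sqr_ge0 (a n); lra.
elim: n => [|n IH]; first by rewrite big_ord0; lra.
by rewrite big_ord_recr/=; have := h n; lra.
Qed.

Section AlmostSureLimit.
Context (R : realType) (d : measure_display) (Omega : measurableType d)
  (P : probability Omega R) (F : probability R R) (Pi : Omega -> set (Pt R)) (a : R).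
Hypothesis hmiss : @miss_law _ _ _ _ (markedPt R) P Pi (intensity_measure F).
Hypotheses (a0 : 0 < a) (ea : (\int[F]_x (expR (a * x))%:E < +oo)%E).

Let ae_bdd := ae_lpp_bounded hmiss a0 ea.
Let f := mean_defect P Pi.

Lemma mean_defect_ge0 C r : 0 <= f C r.
Proof. by apply: Ex_ge0 => w; exact: defect_ge0. Qed.

Lemma mean_defect_le C r : 0 <= C -> 0 < r -> f C r <= C * r.
Proof.
move=> C0 r0; rewrite -[leRHS](Ex_cst P); apply: Ex_le.
- exact: (bounded_defect hmiss C0 (ltW r0) (below_square r0)).
- exact: bounded_rv_cst.
- by move=> w; apply: defect_le; [exact: LPP_ge0|rewrite mulr_ge0// ltW].
Qed.

Lemma mean_defect_mulrn C r x n : 0 <= C -> 0 < r -> 0 < x ->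
  f C (n%:R * r + x) <= n%:R * f C r + f C x.
Proof.
move=> C0 r0 x0; elim: n => [|n IH]; first by rewrite !mul0r !add0r.
have -> : n.+1%:R * r + x = r + (n%:R * r + x) by rewrite mulrSr; ring.
apply: (le_trans (mean_defect_subadd hmiss a0 ea C0 r0 _)).
  by rewrite ltr_wpDl// mulr_ge0// ltW.
by rewrite [n.+1%:R]mulrSr mulrDl mul1r; move: IH; rewrite -/f; lra.
Qed.

Definition defect_rate C : R := inf [set f C r / r | r in [set r | 0 < r]].

Lemma has_inf_rate C : has_inf [set f C r / r | r in [set r | 0 < r]].
Proof.
split; first by exists (f C 1 / 1), 1 => //=; exact: ltr01.
by exists 0 => _ [r /= r0 <-]; rewrite divr_ge0 ?mean_defect_ge0// ltW.
Qed.

Lemma defect_rate_le C r : 0 < r -> defect_rate C <= f C r / r.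
Proof. by move=> r0; apply: ge_inf; [case: (has_inf_rate C)|exists r]. Qed.

(** Fekete's argument: [u k] is a multiple of a nearly optimal [r] plus a remainder in []0, r]],
    which costs at most [C * r] and disappears after division. *)
Lemma mean_defect_cvg C (u : nat -> R) : 0 <= C ->
  (forall k, 0 < u k) -> u k @[k --> \oo] --> +oo ->
  f C (u k) / u k @[k --> \oo] --> defect_rate C.
Proof.
move=> C0 u0 uoo; apply/cvgrPdist_le => e e0.
have e2 : 0 < e / 2 by lra.
have [_ [r /= r0 <-] hr] := inf_adherent e2 (has_inf_rate C).
have : \forall k \near \oo, C * r / (e / 2) <= u k.
  by move/cvgryPge : uoo => /(_ (C * r / (e / 2))).
apply: filterS => k hk.
have lb := defect_rate_le C (u0 k).
have ub : f C (u k) / u k <= f C r / r + C * r / u k.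
  have q0 : 0 < u k / r by rewrite divr_gt0.
  have [i1 i2] := ceil_idxP q0; set i := ceil_idx _ in i1 i2.
  have x0 : 0 < u k - i%:R * r by rewrite subr_gt0 -ltr_pdivlMr.
  have xr : u k - i%:R * r <= r.
    by rewrite lerBlDl -[X in _ + X]mul1r -mulrDl -mulrSr -ler_pdivrMr.
  rewrite ler_pdivrMr// mulrDl divfK ?gt_eqF//.
  have -> : u k = i%:R * r + (u k - i%:R * r) by ring.
  apply: (le_trans (mean_defect_mulrn i C0 r0 x0)).
  rewrite [X in _ <= _ * X + _](_ : _ = u k); last by ring.
  apply: lerD.
    rewrite mulrAC -mulrA [leLHS]mulrC ler_wpM2l ?mean_defect_ge0//.
    exact: ltW.
  apply: (le_trans (mean_defect_le C0 x0)); exact: ler_wpM2l.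
have ck : C * r / u k <= e / 2.
  by rewrite ler_pdivrMr// [leRHS]mulrC -ler_pdivrMr//.
rewrite ler_norml; apply/andP; split.
  by move: hr; rewrite -/(defect_rate C) => hr; lra.
lra.
Qed.

(** For [r >= 1] the passage time stays below [b * r] with probability at least 1/2, and there the
    defect is at least [r] as soon as [C >= b + 1]. *)
Lemma defect_rate_lb : exists C0, 0 < C0 /\ forall C, C0 <= C -> 0 < defect_rate C.
Proof.
set m := Num.sqrt (exp_moment F a).
have m0 : 0 <= m by exact: sqrtr_ge0.
have l2 : 0 < ln 2 :> R by apply: ln_gt0; rewrite ltr1n.
(* With this [b] the tail bound at [b * r] is [expR (- ln 2 * r)], at most 1/2 for [r >= 1]. *)
pose b := (2 * m + ln 2) / a.
have b0 : 0 < b by rewrite divr_gt0//; lra.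
have ab : a * b = 2 * m + ln 2 by rewrite /b mulrC divfK// gt_eqF.
exists (b + 1); split; first by lra.
move=> C bC; have C0 : 0 <= C by lra.
have lb r : 1 <= r -> 1 / 2 <= f C r / r.
  move=> r1; have r0 : 0 < r by lra.
  have sq := below_square r0.
  have tf : test_fun (defect (C * r)) by apply: test_fun_defect; rewrite mulr_ge0// ltW.
  rewrite ler_pdivlMr//.
  have := expect_LPP_cvg hmiss ae_bdd tf sq; rewrite -[X in _ --> X]/(f C r) => cv.
  rewrite -lerN2; apply: (@ler_lim_le _ (fun n => - Ex P (fun w => defect (C * r) (grid_LPP Pi (0, 0) (r, r) n w)))).
    exact: cvgN.
  move=> n; rewrite lerN2.
  pose G := [set w | b * r < grid_LPP Pi (0, 0) (r, r) n w].
  have mG : measurable G by apply: measurable_gt_set; exact: (measurable_grid_LPP hmiss).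
  have bG := bounded_rv_indic R mG.
  apply: (@le_trans _ _ (Ex P (fun w => r - r * \1_G w))); last first.
    apply: Ex_le.
    - by apply: bounded_rvB; [exact: bounded_rv_cst|exact: bounded_rvZ].
    - exact: (bounded_grid_LPP hmiss n (defect (C * r)) sq).
    - move=> w; rewrite indicE; case: (boolP (w \in G)) => [_|/negP wG].
        by rewrite mulr1 subrr defect_ge0.
      rewrite mulr0 subr0; apply: le_trans (defect_ge _ _).
      have : grid_LPP Pi (0, 0) (r, r) n w <= b * r.
        by rewrite leNgt; apply/negP => h; apply: wG; rewrite inE.
      have : (b + 1) * r <= C * r by rewrite ler_pM2r.
      lra.
  rewrite ExB; [|exact: bounded_rv_cst|exact: bounded_rvZ].
  rewrite Ex_cst ExZ//.
  have : Ex P \1_G <= 1 / 2.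
    apply: (le_trans (prob_grid_LPP_gt hmiss a0 ea n sq (b * r))).
    have -> : area (0, 0) (r, r) = r ^+ 2 by rewrite /area /=; ring.
    rewrite sqrtrM ?sqr_ge0// sqrtr_sqr gtr0_norm// -/m [a * (b * r)]mulrA ab.
    rewrite -[1 / 2]lnK ?posrE; last by lra.
    rewrite ler_expR ln_div ?posrE// ln1.
    have : ln 2 * 1 <= ln 2 * r by rewrite ler_pM2l.
    by lra.
  have := r0; nra.
apply: (@lt_le_trans _ _ (1 / 2)); first by lra.
rewrite -lerN2; have cv : f C k.+1%:R / k.+1%:R @[k --> \oo] --> defect_rate C.
  apply: mean_defect_cvg => //.
  by apply/cvgryPge => A; exact: near_ge_nat.
apply: (@ler_lim_le _ (fun k => - (f C (k.+1%:R) / k.+1%:R))); first exact: cvgN.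
by move=> k; rewrite lerN2; apply: lb; rewrite ler1n.
Qed.

Let v C r := (mean_sqr_defect P Pi C r - f C r ^+ 2) / r ^+ 2.

Lemma expect_deviation_sqr C r p q : 0 <= C -> 0 < r -> below p q -> area p q = r ^+ 2 ->
  let Y := fun w => (defect (C * r) (LPP (Pi w) p q) - f C r) / r in
  bounded_rv Y /\ Ex P (fun w => Y w ^+ 2) = v C r.
Proof.
move=> C0 r0 pq e Y.
have bX := bounded_defect hmiss C0 (ltW r0) pq.
have bc := bounded_rv_cst Omega.
have [e1 e2] := expect_box_defect hmiss a0 ea C0 r0 pq e.
pose X w := defect (C * r) (LPP (Pi w) p q).
have bX2 : bounded_rv (fun w => X w ^+ 2) := bounded_rvM bX bX.
split.
  by apply: bounded_rvM; [apply: bounded_rvB => //; exact: bc|exact: bc].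
have YE w : Y w ^+ 2 = r ^- 2 * ((X w ^+ 2 - (2 * f C r) * X w) + f C r ^+ 2).
  by rewrite /Y /X; field; rewrite gt_eqF.
have -> : (fun w => Y w ^+ 2) = (fun w => r ^- 2 * ((X w ^+ 2 - (2 * f C r) * X w) + f C r ^+ 2)).
  exact/funext.
have bXf : bounded_rv (fun w => (2 * f C r) * X w) by exact: bounded_rvZ.
rewrite ExZ; last by apply: bounded_rvD; [exact: bounded_rvB|exact: bc].
rewrite ExD; [|exact: bounded_rvB|exact: bc].
rewrite ExB// ExZ// Ex_cst e2 e1 /v -/f.
by field; rewrite gt_eqF.
Qed.

Lemma variance_ge0 C r : 0 <= C -> 0 < r -> 0 <= v C r.
Proof.
move=> C0 r0; have e : area (0, 0) (r, r) = r ^+ 2 by rewrite /area /=; ring.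
have [_ <-] := expect_deviation_sqr C0 r0 (below_square r0) e.
by apply: Ex_ge0 => w; exact: sqr_ge0.
Qed.

(** Dividing [mean_sqr_defect_double] by the square of the doubled side gives exactly the hypothesis
    of [sum_recursion_le]. *)
Lemma variance_summable C r : 0 <= C -> 0 < r ->
  exists B, forall n, \sum_(k < n) v C (2 ^+ k * r) <= B.
Proof.
move=> C0 r0.
pose al k := f C (2 ^+ k * r) / (2 ^+ k * r).
exists (2 * (v C (2 ^+ 0 * r) + al 0%N ^+ 2)).
have p0 k : 0 < 2 ^+ k * r by rewrite mulr_gt0// exprn_gt0.
apply: (@sum_recursion_le _ (fun k => v C (2 ^+ k * r)) al) => k; first exact: variance_ge0.
have := mean_sqr_defect_double hmiss a0 ea C0 (p0 k).
have E : 2 ^+ k.+1 * r = 2 ^+ k * r + 2 ^+ k * r by rewrite exprS; ring.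
rewrite /al /v !E -/f.
have := p0 k; move: (2 ^+ k * r) => t t0.
set s2 := mean_sqr_defect P Pi C (t + t); set f2 := f C (t + t).
set s1 := mean_sqr_defect P Pi C t; set f1 := f C t => h.
have -> : (s2 - f2 ^+ 2) / (t + t) ^+ 2 + (f2 / (t + t)) ^+ 2 = s2 / 4 / t ^+ 2.
  by field; rewrite !gt_eqF// addr_gt0.
have -> : (s1 - f1 ^+ 2) / t ^+ 2 / 2 + (f1 / t) ^+ 2 = ((s1 + f1 ^+ 2) / 2) / t ^+ 2.
  by field; rewrite gt_eqF.
rewrite ler_pM2r ?invr_gt0 ?exprn_gt0//.
by lra.
Qed.

Definition scale_pt (c : R) (p : R * R) := (c * p.1, c * p.2).

Lemma ae_LPP_cvg C p q : 0 <= C -> 0 < defect_rate C -> below p q -> {ae P, forall w,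
  LPP (Pi w) (scale_pt (2 ^+ k) p) (scale_pt (2 ^+ k) q) / 2 ^+ k @[k --> \oo]
    --> (C - defect_rate C) * Num.sqrt (area p q)}.
Proof.
move=> C0 g0 pq; set r := Num.sqrt (area p q).
have A0 : 0 < area p q by case/andP: pq => *; rewrite mulr_gt0// subr_gt0.
have r0 : 0 < r by rewrite sqrtr_gt0.
have r2 : r ^+ 2 = area p q by rewrite sqr_sqrtr// ltW.
have e0 k : 0 < 2 ^+ k :> R by rewrite exprn_gt0.
have p0 k : 0 < 2 ^+ k * r by rewrite mulr_gt0.
have pqk k : below (scale_pt (2 ^+ k) p) (scale_pt (2 ^+ k) q).
  by case/andP: pq => pq1 pq2; rewrite /below /= !ltr_pM2l// pq1.
have ark k : area (scale_pt (2 ^+ k) p) (scale_pt (2 ^+ k) q) = (2 ^+ k * r) ^+ 2.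
  by rewrite exprMn r2 /area /=; ring.
pose L k w := LPP (Pi w) (scale_pt (2 ^+ k) p) (scale_pt (2 ^+ k) q).
pose Y k w := (defect (C * (2 ^+ k * r)) (L k w) - f C (2 ^+ k * r)) / (2 ^+ k * r).
have hY k := expect_deviation_sqr C0 (p0 k) (pqk k) (ark k).
have [B hB] := variance_summable C0 r0.
have hs n : \sum_(k < n) Ex P (fun w => Y k w ^+ 2) <= B.
  apply: le_trans (hB n); rewrite le_eqVlt; apply/orP; left; apply/eqP.
  by apply: eq_bigr => k _; exact: (proj2 (hY k)).
apply: filterS (ae_cvg0_summable (fun k => proj1 (hY k)) hs) => w hw.
have uoo : 2 ^+ k * r @[k --> \oo] --> +oo.
  apply/cvgryPge => A; apply: filterS (near_ge_nat (A / r)) => k.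
  rewrite ler_pdivrMr// => /le_trans; apply; rewrite ler_pM2r// -natrX ler_nat.
  by rewrite ltn_expl.
have cD : Y k w + f C (2 ^+ k * r) / (2 ^+ k * r) @[k --> \oo] --> 0 + defect_rate C.
  exact: cvgD hw (mean_defect_cvg C0 p0 uoo).
have {}cD : defect (C * (2 ^+ k * r)) (L k w) / (2 ^+ k * r) @[k --> \oo] --> defect_rate C.
  rewrite add0r in cD; apply: cvg_near_eq _ cD; apply: nearW => k.
  by rewrite -mulrDl subrK.
(* A positive limit forces the defect to be positive eventually; it is then the plain difference,
   from which [L k w] is recovered. *)
have h : \forall k \near \oo, 0 < defect (C * (2 ^+ k * r)) (L k w) / (2 ^+ k * r).
  by move/cvgr_gt : cD; apply.
have c2 : (C - defect (C * (2 ^+ k * r)) (L k w) / (2 ^+ k * r)) * r @[k --> \oo]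
    --> (C - defect_rate C) * r.
  by apply: cvgM; [apply: cvgB => //; exact: cvg_cst|exact: cvg_cst].
apply: cvg_near_eq _ c2; apply: filterS h => k.
rewrite pmulr_lgt0 ?invr_gt0// /defect lt_max ltxx orbF => h.
rewrite (max_idPl _) ?ltW// -/(L k w).
by field; rewrite !gt_eqF.
Qed.

End AlmostSureLimit.

(** * Positivity and identification of the time constant *)

Section TimeConstant.
Context (R : realType) (d : measure_display) (Omega : measurableType d)
  (P : probability Omega R) (F : probability R R) (Pi : Omega -> set (Pt R)) (a : R).
Hypothesis hmiss : @miss_law _ _ _ _ (markedPt R) P Pi (intensity_measure F).
Hypotheses (a0 : 0 < a) (ea : (\int[F]_x (expR (a * x))%:E < +oo)%E).
Hypothesis F0 : F `]-oo, 0]%classic = 0%E.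

Let ae_bdd := ae_lpp_bounded hmiss a0 ea.
Let f := mean_defect P Pi.
Let L (r : R) w := LPP (Pi w) (0, 0) (r, r).

Lemma ae_exists (Q : Omega -> Prop) : {ae P, forall w, Q w} -> exists w, Q w.
Proof.
move=> h; have P1 : (0 < P [set: Omega])%E by rewrite probability_setT lte01.
have PF : ProperFilter (almost_everywhere P).
  by apply: ae_properfilter_algebraOfSetsType; exact: P1.
exact: filter_ex h.
Qed.

Lemma exists_heavy_weight : exists2 u, 0 < u & (0 < F `]u, +oo[%classic)%E.
Proof.
apply: contrapT => h.
have Fz (n : nat) : F `]n.+1%:R^-1, +oo[%classic = 0%E.
  apply/eqP; rewrite eq_le measure_ge0 andbT leNgt; apply/negP => hn.
  by apply: h; exists n.+1%:R^-1 => //; rewrite invr_gt0.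
have F1 : F.-negligible (\bigcup_n `]n.+1%:R^-1, +oo[%classic).
  by apply: negligible_bigcup => n; apply/negligibleP => //; exact: Fz.
have F2 : F.-negligible `]-oo, 0]%classic by apply/negligibleP.
have : F.-negligible [set: R].
  apply: negligibleS (negligibleU F2 F1) => x _.
  have [x0|x0] := leP x 0; first by left; rewrite /= in_itv.
  right; exists (Num.truncn x^-1) => //=; rewrite in_itv/= andbT.
  by rewrite invf_plt ?posrE// truncnS_gt.
move/negligibleP => /(_ measurableT) FT.
have : F [set: R] = 0%E by exact: FT.
by rewrite probability_setT => /eqP; rewrite onee_eq0.
Qed.

Lemma bounded_truncated C r : 0 <= C -> 0 < r ->
  bounded_rv (fun w => C * r - defect (C * r) (L r w)) /\
  Ex P (fun w => C * r - defect (C * r) (L r w)) = C * r - f C r.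
Proof.
move=> C0 r0; have b := bounded_defect hmiss C0 (ltW r0) (below_square r0).
by split; [apply: bounded_rvB; [exact: bounded_rv_cst|exact: b]|
  rewrite ExB ?Ex_cst//; exact: bounded_rv_cst].
Qed.

Lemma truncatedE (c y : R) : c - defect c y = Num.min y c.
Proof. by rewrite /defect /Num.max /Num.min; do 2 case: ltP => ?; lra. Qed.

(** With positive probability the unit square contains a point of weight above [u], which is a chain
    by itself. This is what makes the time constant positive. *)
Lemma expect_truncated_gt0 C : 0 < C -> 0 < C * 1 - f C 1.
Proof.
move=> C0; have [u u0 Fu] := exists_heavy_weight.
have [b <-] := bounded_truncated (ltW C0) ltr01.
pose A : set (Pt R) := (`]0, 1]%classic `*` `]0, 1]%classic) `*` `]u, +oo[%classic.
have mA : @measurable _ (markedPt R) A.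
  by apply: measurableX; [apply: measurableX|]; exact: measurable_itv.
have muA : intensity_measure F A = F `]u, +oo[%classic.
  by rewrite intensity_box// !subr0 mulr1 mul1e.
have fA : (intensity_measure F A < +oo)%E.
  by rewrite muA (le_lt_trans (probability_le1 _ _)) ?ltry.
have [mM PM] := hmiss mA fA.
pose H := hit (X := markedPt R) Pi A.
have mH : measurable H by exact: measurableC.
have PH : Ex P \1_H = 1 - expR (- fine (F `]u, +oo[%classic)).
  rewrite Ex_indic// /H /hit probability_setC//.
  by rewrite PM muA -EFinB.
have PH0 : 0 < Ex P \1_H.
  rewrite PH subr_gt0 expR_lt1 oppr_lt0 fine_gt0// Fu/=.
  by rewrite -muA.
have bH := bounded_rv_indic R mH.
pose m := Num.min u C.
have m0 : 0 < m by rewrite lt_min u0.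
apply: (@lt_le_trans _ _ (m * Ex P \1_H)); first by rewrite mulr_gt0.
rewrite -ExZ//; apply: Ex_le_ae => //; first exact: bounded_rvZ.
apply: filterS (ae_bdd (below_square ltr01)) => w wb.
rewrite truncatedE mulr1 indicE; case: (boolP (w \in H)) => [/set_mem wH|_]; last first.
  by rewrite mulr0 le_min LPP_ge0 ltW.
have [z [Pz [[z1 z2] z3]]] : Pi w `&` A !=set0 by apply/set0P/negP => /eqP e; apply: wH.
rewrite mulr1 le_min [m <= C]ge_min lexx orbT andbT.
apply: (@le_trans _ _ z.2).
  by move: z3; rewrite /m ge_min /= in_itv/= andbT => /ltW ->.
apply: ub_le_sup => //; exists [:: z]; last by rewrite big_seq1.
by split => // y; rewrite inE => /eqP ->.
Qed.

Lemma time_constant : exists2 g : R, 0 < g & gammaF P Pi = g%:E /\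
  forall p q, below p q -> {ae P, forall w,
    LPP (Pi w) (scale_pt (2 ^+ k) p) (scale_pt (2 ^+ k) q) / 2 ^+ k @[k --> \oo]
      --> g * Num.sqrt (area p q)}.
Proof.
have [C0 [C00 lb]] := defect_rate_lb hmiss a0 ea.
pose rate := defect_rate P Pi.
pose g := C0 - rate C0.
(* Both expressions are almost sure limits of the same passage times, so they agree at any sample
   point where both limits hold. *)
have gE C : C0 <= C -> C - rate C = g.
  move=> CC; have C1 : 0 <= C by lra.
  have h1 := ae_LPP_cvg hmiss a0 ea C1 (lb _ CC) (below_square ltr01).
  have h2 := ae_LPP_cvg hmiss a0 ea (ltW C00) (lb _ (lexx _)) (below_square ltr01).
  have [w [w1 w2]] := ae_exists (filterI h1 h2).
  have := cvg_seq_unique w1 w2.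
  have -> : area (0, 0) (1, 1) = 1 :> R by rewrite /area /= !subr0 mulr1.
  by rewrite sqrtr1 !mulr1.
have ub C r : C0 <= C -> 0 < r -> C * r - f C r <= g * r.
  move=> CC r0; rewrite -(gE C CC) mulrBl lerD2l lerN2 -ler_pdivlMr//.
  exact: defect_rate_le.
have g0 : 0 < g.
  apply: (lt_le_trans (expect_truncated_gt0 C00)).
  by have := ub C0 1 (lexx _) ltr01; rewrite [g * 1]mulr1.
have mL r : 0 < r -> measurable_fun setT (L r).
  by move=> r0; exact: (measurable_LPP hmiss (below_square r0)).
have intL r : 0 < r -> (\int[P]_w (L r w)%:E <= (g * r)%:E)%E.
  (* The truncations [min (L r w) (C k * r)] increase to [L r w], and all of them satisfy the same
     bound [g * r] on the mean. *)
  move=> r0; pose C k : R := C0 + k%:R.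
  have CC k : C0 <= C k by rewrite lerDl.
  have C1 k : 0 <= C k by rewrite (le_trans (ltW C00)).
  pose h k w := ((C k * r - defect (C k * r) (L r w))%:E : \bar R).
  have hlim w : limn (h ^~ w) = (L r w)%:E.
    apply: cvg_lim => //; apply: cvg_near_cst.
    apply: filterS (near_ge_nat (L r w / r + 1)) => k hk.
    rewrite /h truncatedE; congr EFin; apply/min_idPl.
    rewrite -ler_pdivrMr//; move: hk; rewrite [k.+1%:R]mulrSr /C; lra.
  have mono : (\int[P]_w h k w)%E @[k --> \oo] --> (\int[P]_w (L r w)%:E)%E.
    under [X in _ --> X]eq_integral do rewrite -hlim.
    apply: cvg_monotone_convergence => //.
    - move=> k; apply/measurable_EFinP.
      by case: (bounded_truncated (C1 k) r0) => -[].
    - by move=> k w _; rewrite lee_fin truncatedE le_min LPP_ge0/= mulr_ge0// ltW.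
    - move=> w _ k l kl; rewrite lee_fin !truncatedE le_min ge_min lexx/=.
      rewrite ge_min; apply/orP; right.
      by apply: ler_wpM2r; [exact: ltW|rewrite /C lerD2l ler_nat].
  rewrite -(cvg_lim _ mono)//; apply: lime_le.
    by apply/cvg_ex; exists (\int[P]_w (L r w)%:E)%E.
  apply: nearW => k; rewrite EFin_Ex; last by case: (bounded_truncated (C1 k) r0).
  by rewrite lee_fin (proj2 (bounded_truncated (C1 k) r0)); exact: ub.
exists g => //; split; last first.
  by move=> p q pq; exact: (ae_LPP_cvg hmiss a0 ea (ltW C00) (lb _ (lexx _)) pq).
apply/eqP; rewrite eq_le; apply/andP; split.
  apply: ge_ereal_sup => _ [n /= n0 <-].
  have n0' : 0 < n%:R :> R by rewrite ltr0n.
  have -> : g%:E = ((g * n%:R)%:E * (n%:R^-1)%:E)%E by rewrite -EFinM mulfK// gt_eqF.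
  by apply: lee_wpmul2r; [rewrite lee_fin invr_ge0 ltW|exact: intL].
(* Lower bound on [gammaF] from squares of side [2 ^ n], where the passage time dominates its
   truncation. *)
have lbg n : ((C0 - f C0 (2 ^+ n) / 2 ^+ n)%:E <= gammaF P Pi)%E.
  apply: le_trans (ereal_sup_ubound _); last by exists (2 ^ n)%N => //=; rewrite expn_gt0.
  have p0 : 0 < 2 ^+ n :> R by rewrite exprn_gt0.
  have [b e] := bounded_truncated (ltW C00) p0.
  have -> : (C0 - f C0 (2 ^+ n) / 2 ^+ n) = (C0 * 2 ^+ n - f C0 (2 ^+ n)) / 2 ^+ n.
    by field; rewrite gt_eqF.
  rewrite natrX EFinM; apply: lee_wpmul2r; first by rewrite lee_fin invr_ge0 ltW.
  rewrite -e -EFin_Ex//; apply: ge0_le_integral => //.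
  - by move=> w _; rewrite lee_fin truncatedE le_min LPP_ge0/= mulr_ge0// ltW.
  - by apply/measurable_EFinP; case: b.
  - by apply/measurable_EFinP; exact: mL.
  - by move=> w _; rewrite lee_fin truncatedE ge_min lexx.
have cv : (C0 - f C0 (2 ^+ n) / 2 ^+ n)%:E @[n --> \oo] --> g%:E.
  apply/cvg_EFin; first exact: nearW.
  apply: cvgB; first exact: cvg_cst.
  apply: (mean_defect_cvg hmiss a0 ea (ltW C00)) => //.
  apply/cvgryPge => A; apply: filterS (near_ge_nat A) => k /le_trans; apply.
  by rewrite -natrX ler_nat ltn_expl.
rewrite -(cvg_lim _ cv)//; apply: lime_le; last exact: nearW.
by apply/cvg_ex; exists g%:E.
Qed.

End TimeConstant.

(** * Uniform limit shape *)

Section UniformLimit.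
Context (R : realType) (C : set (Pt R)) (g : R).
Hypothesis g0 : 0 < g.
Hypothesis bdd : forall p q, has_ubound (chain_sums C p q).

Definition grid_corner (N : nat) (a : int) (e : nat) : R * R :=
  (a%:~R / N.+1%:R, e%:R / N.+1%:R).

Hypothesis lim_grid : forall (N : nat) (a b : int) (e : nat), a < b -> (0 < e)%N ->
  LPP C (scale_pt (2 ^+ k) (grid_corner N a 0)) (scale_pt (2 ^+ k) (grid_corner N b e)) / 2 ^+ k
    @[k --> \oo] --> g * Num.sqrt ((b - a)%:~R / N.+1%:R * (e%:R / N.+1%:R)).

Let L (z x t : R) := LPP C (z, 0) (x, t).

Lemma L_ge0 z x t : 0 <= L z x t.
Proof. exact: LPP_ge0. Qed.

Lemma sqrt_le_add (A B D : R) : 0 <= B -> 0 <= D -> A <= B + D ->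
  Num.sqrt A <= Num.sqrt B + Num.sqrt D.
Proof.
move=> B0 D0 ABD; apply: (@le_trans _ _ (Num.sqrt (B + D))); first exact: ler_wsqrtr.
have sB := sqrtr_ge0 B; have sD := sqrtr_ge0 D.
rewrite -[leRHS]ger0_norm ?addr_ge0// -sqrtr_sqr; apply: ler_wsqrtr.
have := sqr_sqrtr B0; have := sqr_sqrtr D0; nra.
Qed.

Lemma dyadic_scale (t : R) : 1 <= t -> exists k, 2 ^+ k <= t < 2 ^+ k.+1.
Proof.
move=> t1; have t0 : 0 <= t by lra.
have n1 : (0 < Num.truncn t)%N by rewrite truncn_gt0.
exists (trunc_log 2 (Num.truncn t)); apply/andP; split.
  apply: (@le_trans _ _ (Num.truncn t)%:R); last by rewrite truncn_le.
  by rewrite -natrX ler_nat trunc_logP.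
apply: (lt_le_trans (truncnS_gt t)).
by rewrite -natrX ler_nat trunc_log_ltn.
Qed.

(** Only finitely many mesh boxes have indices below [m], so one threshold serves them all; signed
    columns are shifted by [m] to become ordinals. *)
Lemma near_grid (N m : nat) (e : R) : 0 < e -> exists k0, forall k, (k0 <= k)%N ->
  forall (a b : int) (l : nat), a < b -> (0 < l)%N -> (l < m)%N ->
   (`|a|%N < m)%N -> (`|b|%N < m)%N ->
  `|LPP C (scale_pt (2 ^+ k) (grid_corner N a 0)) (scale_pt (2 ^+ k) (grid_corner N b l))
    - 2 ^+ k * (g * Num.sqrt ((b - a)%:~R / N.+1%:R * (l%:R / N.+1%:R)))| <= 2 ^+ k * e.
Proof.
move=> e0.
pose Q (x : ('I_(m + m) * 'I_(m + m) * 'I_m)%type) (k : nat) :=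
  let a := (x.1.1 : nat)%:Z - m%:Z in let b := (x.1.2 : nat)%:Z - m%:Z in
  a < b -> (0 < x.2)%N ->
  `|LPP C (scale_pt (2 ^+ k) (grid_corner N a 0)) (scale_pt (2 ^+ k) (grid_corner N b x.2))
    - 2 ^+ k * (g * Num.sqrt ((b - a)%:~R / N.+1%:R * (x.2%:R / N.+1%:R)))| <= 2 ^+ k * e.
have : \forall k \near \oo, forall x, x \in enum {: 'I_(m + m) * 'I_(m + m) * 'I_m} -> Q x k.
  apply: near_all_seq => x _; rewrite /Q.
  set a := _ - _; set b := _ - _.
  have [ab|ab] := boolP (a < b); last by near=> k.
  have [l0|l0] := boolP (0 < x.2)%N; last by near=> k.
  have /cvgrPdist_le /(_ e e0) := @lim_grid N a b x.2 ab l0.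
  apply: filterS => k h _ _; have p0 : 0 < 2 ^+ k :> R by rewrite exprn_gt0.
  set y := LPP _ _ _ in h *; set G := g * _ in h *.
  have -> : y - 2 ^+ k * G = - (2 ^+ k * (G - y / 2 ^+ k)) by field; rewrite gt_eqF.
  by rewrite normrN normrM (gtr0_norm p0) ler_pM2l.
move=> [k0 _ hk0]; exists k0 => k kk a b l ab l0 lm am bm.
have ia : (absz (a + m%:Z)%R < m + m)%N by lia.
have ib : (absz (b + m%:Z)%R < m + m)%N by lia.
have := hk0 k kk ((Ordinal ia, Ordinal ib), Ordinal lm) (mem_enum _ _).
rewrite /Q/=.
have -> : (absz (a + m%:Z)%R)%:Z - m%:Z = a by lia.
have -> : (absz (b + m%:Z)%R)%:Z - m%:Z = b by lia.
exact.
Unshelve. all: by end_near.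
Qed.

(** Area error when a box is moved to the mesh [nu]: two cells in width and one in height, hence
    [4 * K] from the width, 4 from the height and 2 from the corner term. *)
Lemma grid_prod_le (K nu u v p q : R) : 0 < nu -> nu <= 1 -> 0 <= u -> 0 <= v ->
  0 <= p -> 0 <= q -> p <= 4 * K -> q <= 2 -> u <= p + 2 * nu -> v <= q + nu ->
  u * v <= p * q + (4 * K + 6) * nu.
Proof.
move=> nu0 nu1 u0 v0 p0 q0 pK q2 up vq.
apply: (@le_trans _ _ ((p + 2 * nu) * (q + nu))); first exact: ler_pM.
have : nu * p <= nu * (4 * K) by rewrite ler_pM2l.
have : nu * q <= nu * 2 by rewrite ler_pM2l.
have : nu * nu <= nu * 1 by rewrite ler_pM2l.
lra.
Qed.

(** Here [l] and [l'] are the passage times of the box and of a mesh box inside it at scale [T];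
    [s], [sB] and [sD] are the roots of the two rescaled areas and of the area error. *)
Lemma lower_estimate (T s sB sD l' l e t : R) : 0 < T -> s <= sB + sD -> g * sD <= e / 2 ->
  - (T * (e / 2)) <= l' - T * (g * sB) -> l' <= l -> T * e <= t * e ->
  - (e * t) <= l - g * (T * s).
Proof.
move=> T0 h1 h2 h3 h4 h5.
have : T * (g * s) <= T * (g * (sB + sD)) by rewrite !ler_pM2l.
have : T * (g * sD) <= T * (e / 2) by rewrite ler_pM2l.
lra.
Qed.

Lemma upper_estimate (T s sB sD l' l e t : R) : 0 < T -> sB <= s + sD -> g * sD <= e / 2 ->
  l' - T * (g * sB) <= T * (e / 2) -> l <= l' -> T * e <= t * e ->
  l - g * (T * s) <= e * t.
Proof.
move=> T0 h1 h2 h3 h4 h5.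
have : T * (g * sB) <= T * (g * (s + sD)) by rewrite !ler_pM2l.
have : T * (g * sD) <= T * (e / 2) by rewrite ler_pM2l.
lra.
Qed.

(** Dividing by the power of 2 just below [t] brings the box into a bounded window, where it is
    squeezed between two mesh boxes. *)
Lemma uniform_limit K e : 0 < K -> 0 < e -> exists T0, forall t, T0 <= t -> 0 < t ->
  forall z x, - (K * t) <= z -> z <= x -> x <= K * t ->
  `|L z x t - g * Num.sqrt ((x - z) * t)| <= e * t.
Proof.
move=> K0 e0; pose D := 4 * K + 6.
have D0 : 0 < D by rewrite /D; lra.
(* An area error [d] costs [g * sqrt d = e / 2]; [N] is taken so that the mesh error [D / N.+1] is
   at most [d]. *)
pose d := (e / 2 / g) ^+ 2.
have eg : 0 < e / 2 / g by rewrite !divr_gt0.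
have d0 : 0 < d by rewrite exprn_gt0.
pose N := Num.truncn (D / d).
have Nr0 : 0 < N.+1%:R :> R by rewrite ltr0n.
have DN : D / N.+1%:R <= d.
  by rewrite ler_pdivrMr// -ler_pdivrMl// mulrC ltW// truncnS_gt.
have gD : g * Num.sqrt (D / N.+1%:R) <= e / 2.
  rewrite mulrC -ler_pdivlMr//; apply: le_trans (ler_wsqrtr DN) _.
  by rewrite sqrtr_sqr gtr0_norm.
(* Bounds all mesh indices in play: abscissas up to [2 * K] in absolute value and heights up to 2,
   with room for shifts by one. *)
pose m := (Num.truncn (2 * K * N.+1%:R) + 3 + (2 * N.+1 + 2))%N.
have e20 : 0 < e / 2 by lra.
have [k0 hk0] := near_grid N m e20.
exists (2 ^+ k0) => t kt t0 z x Kz zx xK.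
have t1 : 1 <= t by apply: le_trans kt; rewrite exprn_ege1// ler1n.
have [k /andP[tk1 tk2]] := dyadic_scale t1.
have kk0 : (k0 <= k)%N.
  rewrite leqNgt; apply/negP => lt; have : 2 ^+ k.+1 <= 2 ^+ k0 :> R.
    by rewrite ler_eXn2l// ltr1n.
  by move=> h; move: (lt_le_trans tk2 (le_trans h kt)); rewrite ltxx.
pose T : R := 2 ^+ k.
have T0 : 0 < T by rewrite exprn_gt0.
have tT : t < 2 * T by move: tk2; rewrite exprS.
pose Z := z / T; pose X := x / T; pose S := t / T.
have zE : z = T * Z by rewrite /Z mulrC divfK// gt_eqF.
have xE : x = T * X by rewrite /X mulrC divfK// gt_eqF.
have tE : t = T * S by rewrite /S mulrC divfK// gt_eqF.
have S1 : 1 <= S by rewrite /S ler_pdivlMr// mul1r.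
have S2 : S <= 2 by rewrite /S ler_pdivrMr// ltW.
have ZX : Z <= X by rewrite /Z /X ler_pM2r ?invr_gt0.
have KtT : K * t <= K * (2 * T) by rewrite ler_pM2l// ltW.
have Zl : - (2 * K) <= Z.
  rewrite /Z ler_pdivlMr//; apply: le_trans Kz; lra.
have Xu : X <= 2 * K.
  rewrite /X ler_pdivrMr//; apply: (le_trans xK); lra.
have sqE : Num.sqrt ((x - z) * t) = T * Num.sqrt ((X - Z) * S).
  rewrite zE xE tE (_ : (T * X - T * Z) * (T * S) = T ^+ 2 * ((X - Z) * S)); last by ring.
  by rewrite sqrtrM ?sqr_ge0// sqrtr_sqr gtr0_norm.
set n := N.+1%:R in Nr0 DN gD *.
have n1 : 1 <= n by rewrite /n ler1n.
have ni : 0 < n^-1 by rewrite invr_gt0.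
have ni1 : n^-1 <= 1 by rewrite invf_le1.
have fl (y : R) : (Num.floor y)%:~R <= y /\ y < (Num.floor y)%:~R + 1.
  by have /andP[h1 h2] := floor_itv y; split => //; move: h2; rewrite intrD.
pose a := Num.floor (Z * n); pose b := Num.floor (X * n); pose l := Num.truncn (S * n).
have [a1 a2] := fl (Z * n); have [b1 b2] := fl (X * n).
rewrite -/a in a1 a2; rewrite -/b in b1 b2.
have Sn0 : 0 <= S * n by rewrite mulr_ge0// (le_trans ler01).
have /andP[l1 l2] : l%:R <= S * n < l.+1%:R by exact: truncn_itv.
have l0 : (0 < l)%N by rewrite truncn_gt0 -[1](mulr1 1) ler_pM.
have lm : (l.+1 < m)%N.
  have : (l <= 2 * N.+1)%N.
    by rewrite -(ler_nat R) natrM; apply: (le_trans l1); rewrite ler_pM2r.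
  move=> h; by rewrite /m (leq_trans _ (leq_addl _ _))// addn2 !ltnS.
have Kn0 : 0 <= 2 * K * n by rewrite !mulr_ge0// ltW.
have am (c : int) : `|c%:~R| < 2 * K * n + 2 :> R -> (`|c|%N < m)%N.
  move=> hc; rewrite -(ltr_nat R) natr_absz intr_norm; apply: (lt_le_trans hc).
  rewrite /m !natrD; have := truncnS_gt (2 * K * n); rewrite mulrSr.
  have : 0 <= (2 * N.+1)%:R :> R by [].
  by rewrite -/n; clear; lra.
have Zn1 : - (2 * K * n) <= Z * n by rewrite -mulNr ler_pM2r.
have Xn1 : X * n <= 2 * K * n by rewrite ler_pM2r.
have ZXn : Z * n <= X * n by rewrite ler_pM2r.
pose u := X - Z; pose nu := n^-1.
have u0 : 0 <= u by rewrite /u subr_ge0.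
have u4 : u <= 4 * K by rewrite /u; clear -Xu Zl; lra.
have nun : nu * n = 1 by rewrite /nu mulVf// gt_eqF.
have Tt : T * e <= t * e by rewrite ler_pM2r.
have gcE (c : int) (j : nat) : scale_pt T (grid_corner N c j) = (T * (c%:~R / n), T * (j%:R / n)) by [].
have {}hk0 := hk0 k kk0; rewrite -/T -/n in hk0.
have ab_le : a <= b by apply: le_floor.
have nu0 : 0 < nu := ni.
have nu1 : nu <= 1 := ni1.
have S0 : 0 <= S := le_trans ler01 S1.
have Dn0 : 0 <= D / n by rewrite divr_ge0// ltW.
have uE : u = X - Z by [].
have nuE : nu = n^-1 by [].
have DE : D = 4 * K + 6 by [].
have u1 : u * n = X * n - Z * n by rewrite uE mulrBl.
rewrite -uE in sqE; clearbody u nu; clearbody Z X S; clearbody D d; clearbody a b l m; clearbody T n.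
have le1 (y c : R) : c <= y * n -> c / n <= y by rewrite ler_pdivrMr.
have le2 (y c : R) : y * n <= c -> y <= c / n by rewrite ler_pdivlMr.
have D1 : D / n = D * nu by rewrite nuE.
rewrite sqE ler_norml; apply/andP; split.
  (* The inner mesh box goes from column [a + 1] to [b] and up to row [l]; it may be degenerate,
     hence the maximum with 0. *)
  have A1 : u * S <= Num.max 0 ((b - a - 1)%:~R / n) * (l%:R / n) + D / n.
    set p := Num.max _ _.
    have pu : u <= p + 2 * nu.
      have h : (b - a - 1)%:~R / n <= p by rewrite /p le_max lexx orbT.
      apply: (@le_trans _ _ ((b - a - 1)%:~R / n + 2 * nu)); last by rewrite lerD2r.
      have -> : (b - a - 1)%:~R / n + 2 * nu = (b%:~R - a%:~R + 1) / n.
        by rewrite !intrD !intrN nuE; field; rewrite gt_eqF.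
      by apply: le2; clear -u1 a1 a2 b1 b2; lra.
    have p0 : 0 <= p by rewrite /p le_max lexx.
    have p4 : p <= 4 * K.
      rewrite /p ge_max; apply/andP; split; first by rewrite mulr_ge0// ltW.
      apply: (le_trans _ u4).
      by apply: le1; rewrite !intrD !intrN; clear -u1 a1 a2 b1 b2; lra.
    have q2 : l%:R / n <= S by exact: le1.
    have q0 : 0 <= l%:R / n by rewrite divr_ge0// ltW.
    have qS : S <= l%:R / n + nu.
      have -> : l%:R / n + nu = l.+1%:R / n by rewrite mulrSr mulrDl mul1r nuE.
      by apply: le2; exact: ltW.
    move: (l%:R / n) q2 q0 qS => q q2 q0 qS.
    by rewrite D1 DE; apply: grid_prod_le => //; exact: le_trans q2 S2.
  have B0 : 0 <= Num.max 0 ((b - a - 1)%:~R / n) * (l%:R / n).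
    by apply: mulr_ge0; [rewrite le_max lexx|rewrite divr_ge0// ltW].
  have sA := sqrt_le_add B0 Dn0 A1.
  have [ab|ab] := boolP (a + 1 < b).
    have am1 : (absz (a + 1)%R < m)%N by apply: am; rewrite intrD ltr_norml; apply/andP; split; clear -Zn1 Xn1 ZXn a1 a2 b1 b2 Kn0; lra.
    have bm1 : (`|b|%N < m)%N by apply: am; rewrite ltr_norml; apply/andP; split; clear -Zn1 Xn1 ZXn a1 a2 b1 b2 Kn0; lra.
    have := hk0 (a + 1) b l ab l0 (ltnW lm) am1 bm1.
    have -> : b - (a + 1) = b - a - 1 by ring.
    rewrite ler_norml => /andP[lo _].
    have pos : 0 <= (b - a - 1)%:~R / n.
      by rewrite divr_ge0 ?(ltW Nr0)// ler0z -addrA -opprD subr_ge0 ltW.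
    move: sA; rewrite (max_idPr pos).
    set Bq := Num.sqrt _ in lo * => sA.
    have LL : LPP C (scale_pt T (grid_corner N (a + 1) 0)) (scale_pt T (grid_corner N b l)) <= L z x t.
      rewrite !gcE; apply: LPP_mono => //=.
      - by rewrite zE ler_pM2l//; apply: le2; rewrite intrD ltW.
      - by rewrite mul0r mulr0.
      - by rewrite xE ler_pM2l//; exact: le1.
      - by rewrite tE ler_pM2l//; exact: le1.
    exact: lower_estimate T0 sA gD lo LL Tt.
  (* With no inner box the area itself is within the error, and [L >= 0] is enough. *)
  have neg : (b - a - 1)%:~R / n <= 0 :> R.
    by rewrite pmulr_lle0// lerz0 -addrA -opprD subr_le0 leNgt.
  move: sA; rewrite (max_idPl neg) mul0r sqrtr0 add0r => sA.
  apply: (@lower_estimate T _ 0 _ 0 _ _ _ T0 _ gD _ (L_ge0 z x t) Tt); first by rewrite add0r.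
  by rewrite !mulr0 subr0 oppr_le0 ltW// mulr_gt0.
(* Upper bound, by the outer mesh box from column [a] to [b + 1] and up to row [l.+1]. *)
have ab : a < b + 1 by rewrite ltzD1.
have am1 : (`|a|%N < m)%N by apply: am; rewrite ltr_norml; apply/andP; split; clear -Zn1 Xn1 ZXn a1 a2 b1 b2 Kn0; lra.
have bm1 : (absz (b + 1)%R < m)%N by apply: am; rewrite intrD ltr_norml; apply/andP; split; clear -Zn1 Xn1 ZXn a1 a2 b1 b2 Kn0; lra.
have := hk0 a (b + 1) l.+1 ab (ltn0Sn l) lm am1 bm1.
rewrite ler_norml => /andP[_ up].
have A1 : ((b + 1 - a)%:~R / n) * (l.+1%:R / n) <= u * S + D / n.
  have p1 : (b + 1 - a)%:~R / n <= u + 2 * nu.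
    by apply: le1; rewrite !mulrDl !intrD intrN -mulrA nun; clear -u1 a1 a2 b1 b2; lra.
  have p0 : 0 <= (b + 1 - a)%:~R / n by rewrite divr_ge0 ?(ltW Nr0)// ler0z subr_ge0 ltW.
  have q1 : l.+1%:R / n <= S + nu.
    by apply: le1; rewrite mulrDl nun mulrSr lerD2r.
  rewrite D1 DE; apply: grid_prod_le => //.
    by rewrite divr_ge0// ltW.
have uS0 : 0 <= u * S by rewrite mulr_ge0.
have sA := sqrt_le_add uS0 Dn0 A1.
move: up; set Bq := Num.sqrt _ in sA * => up.
have LL : L z x t <= LPP C (scale_pt T (grid_corner N a 0)) (scale_pt T (grid_corner N (b + 1) l.+1)).
  rewrite !gcE; apply: LPP_mono => //=.
  - by rewrite zE ler_pM2l//; exact: le1.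
  - by rewrite mul0r mulr0.
  - by rewrite xE ler_pM2l//; apply: le2; rewrite intrD ltW.
  - by rewrite tE ler_pM2l//; apply: le2; rewrite ltW.
exact: upper_estimate T0 sA gD up LL Tt.
Qed.

End UniformLimit.

(** * The fluid process *)

Lemma sup_subr (R : realType) (A : set R) (e : R) : has_sup A ->
  sup [set v - e | v in A] = sup A - e.
Proof.
move=> hA; have hB : has_sup [set v - e | v in A].
  split; first by case: (hA) => -[v hv] _; exists (v - e), v.
  by exists (sup A - e) => _ [v hv <-]; rewrite lerD2r; exact: sup_upper_bound.
apply/eqP; rewrite eq_le; apply/andP; split.
  apply: ge_sup; first by case: hB.
  by move=> _ [v hv <-]; rewrite lerD2r; exact: sup_upper_bound.
rewrite lerBlDr; apply: ge_sup; first by case: hA.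
by move=> v hv; rewrite -lerBlDr; apply: sup_upper_bound => //; exists v.
Qed.

Section Fluid.
Context (R : realType) (C : set (Pt R)) (V : R -> R) (g c b : R).
Hypotheses (g0 : 0 < g) (b0 : 0 < b) (cE : c = g / (2 * Num.sqrt b)).
Hypothesis bdd : forall p q, has_ubound (chain_sums C p q).

Let L (z x t : R) := LPP C (z, 0) (x, t).

Hypothesis uniform : forall K e, 0 < K -> 0 < e -> exists T0, forall t, T0 <= t -> 0 < t ->
  forall z x, - (K * t) <= z -> z <= x -> x <= K * t ->
  `|L z x t - g * Num.sqrt ((x - z) * t)| <= e * t.
Hypothesis V_mono : {homo V : x y / x <= y}.
Hypothesis V_pinfty : V x / x @[x --> +oo] --> c.
Hypothesis V_ninfty : V x / x @[x --> -oo] --> c.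

Lemma slope_gt0 : 0 < c.
Proof. by rewrite cE divr_gt0// mulr_gt0// sqrtr_gt0. Qed.

Lemma V_asymp e : 0 < e -> exists2 M, 0 < M & forall x, M <= `|x| -> `|V x - c * x| <= e * `|x|.
Proof.
move=> e0.
have key x : x != 0 -> `|c - V x / x| <= e -> `|V x - c * x| <= e * `|x|.
  move=> x0 h; have -> : V x - c * x = - ((c - V x / x) * x) by field.
  by rewrite normrN normrM ler_wpM2r.
have /cvgrPdist_le /(_ e e0) [M1 [_ h1]] := V_pinfty.
have /cvgrPdist_le /(_ e e0) [M2 [_ h2]] := V_ninfty.
exists (`|M1| + `|M2| + 1) => [|x]; first by rewrite ltr_wpDl// addr_ge0.
have := ler_norm M1; have := ler_norm (- M2); rewrite normrN => m2 m1.
have n1 := normr_ge0 M1; have n2 := normr_ge0 M2.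
have [x0|x0] := leP 0 x.
  rewrite (ger0_norm x0) => hx; rewrite -[in leRHS](ger0_norm x0).
  by apply: key; [rewrite gt_eqF//; lra|apply: h1; lra].
rewrite (ltr0_norm x0) => hx; rewrite -[in leRHS](ltr0_norm x0).
by apply: key; [rewrite lt_eqF//; lra|apply: h2; lra].
Qed.

(** Far from the origin this is [V_asymp]; near it monotonicity bounds [V] by a constant, which
    [e * t] absorbs. *)
Lemma V_linear K e : 0 < K -> 0 < e -> exists T0, forall t, T0 <= t -> 0 < t ->
  forall z, - (K * t) <= z -> z <= K * t -> `|V z - c * z| <= e * t.
Proof.
move=> K0 e0; have c0 := slope_gt0; have [M M0 hM] := V_asymp (divr_gt0 e0 K0).
pose B := `|V M| + `|V (- M)| + c * M.
exists (B / e) => t tB t0 z z1 z2.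
have [Mz|zM] := leP M `|z|.
  apply: (le_trans (hM _ Mz)).
  have zK : `|z| <= K * t by rewrite ler_norml z1 z2.
  have -> : e * t = e / K * (K * t) by field; rewrite gt_eqF.
  by rewrite ler_pM2l// divr_gt0.
move: tB; rewrite ler_pdivrMr// => tB; rewrite [e * t]mulrC; apply: le_trans tB.
move: zM; rewrite ltr_norml => /andP[zM1 zM2].
have v1 := V_mono (ltW zM1); have v2 := V_mono (ltW zM2).
have a1 := ler_norm (V M); have a2 := ler_norm (- V (- M)); rewrite normrN in a2.
have a3 := normr_ge0 (V M); have a4 := normr_ge0 (V (- M)).
have c1 : c * z <= c * M by rewrite ler_pM2l// ltW.
have c2 : c * - M <= c * z by rewrite ler_pM2l// ltW.
rewrite /B ler_norml; apply/andP; split; lra.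
Qed.

Lemma L_bound_mono z x t z' x' t' : z' <= z -> x <= x' -> t <= t' -> L z x t <= L z' x' t'.
Proof. by move=> *; apply: LPP_mono. Qed.

(* Enlarging the time [t] to [- z / K] turns a far exit point into one covered
   by the uniform limit at a single aspect ratio. *)
Lemma tail_le0 : exists K Z, [/\ 0 < K, 0 < Z & forall z x t, z <= - Z -> 0 < t -> x <= - z ->
  K * t <= - z -> V z + L z x t <= 0].
Proof.
have c0 := slope_gt0.
(* This gives [g * sqrt (2 / K) <= c / 4]. Three errors of at most [c / 4 * y], from the root, the
   uniform limit and [V], then stay below the main term [c * y]. *)
have [K K1 K2] : exists2 K, 1 <= K & 2 <= (c / 4 / g) ^+ 2 * K.
  exists (32 * g ^+ 2 / c ^+ 2 + 1).
    by rewrite lerDr; apply: divr_ge0; [apply: mulr_ge0 => //; exact: sqr_ge0|exact: sqr_ge0].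
  have -> : (c / 4 / g) ^+ 2 * (32 * g ^+ 2 / c ^+ 2 + 1) = 2 + c ^+ 2 / (16 * g ^+ 2).
    by field; rewrite !gt_eqF.
  by rewrite lerDl; apply: divr_ge0; [exact: sqr_ge0|apply: mulr_ge0 => //; exact: sqr_ge0].
have K0 : 0 < K by lra.
have c40 : 0 < c / 4 by lra.
have [T0 hT] := uniform K0 c40.
have [M M0 hM] := V_asymp c40.
pose Z := M + K * (`|T0| + 1).
have Z0 : 0 < Z by rewrite /Z ltr_wpDr// mulr_ge0 ?addr_ge0// ltW.
exists K, Z; split => // z x t zZ t0 xz Kt.
have n0 := normr_ge0 T0.
have y0 : 0 < - z by lra.
pose y := - z; pose s := y / K.
have Ks : K * s = y by rewrite /s mulrC divfK// gt_eqF.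
have s0 : 0 < s by rewrite divr_gt0.
have sT : T0 <= s.
  rewrite /s ler_pdivlMr//; have : T0 * K <= K * (`|T0| + 1).
    by rewrite mulrC ler_pM2l//; have := ler_norm T0; lra.
  by rewrite /y; move: zZ; rewrite /Z; lra.
have ts : t <= s by rewrite /s ler_pdivlMr// mulrC.
have h1 : L z x t <= L z y s by apply: L_bound_mono.
have : `|L z y s - g * Num.sqrt ((y - z) * s)| <= c / 4 * s.
  by apply: hT => //; rewrite ?Ks /y; lra.
rewrite ler_norml => /andP[_ h2].
have h3 : g * Num.sqrt ((y - z) * s) <= c / 4 * y.
  have -> : (y - z) * s = y ^+ 2 * (2 / K) by rewrite /s /y; field; rewrite gt_eqF.
  rewrite sqrtrM ?sqr_ge0// sqrtr_sqr gtr0_norm// mulrCA mulrC ler_pM2r//.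
  rewrite mulrC -ler_pdivlMr//.
  have q0 : 0 < c / 4 / g by rewrite !divr_gt0.
  rewrite -(ger0_norm (ltW q0)) -sqrtr_sqr; apply: ler_wsqrtr.
  by rewrite ler_pdivrMr.
have sy : c / 4 * s <= c / 4 * y.
  by rewrite ler_pM2l// /s ler_pdivrMr// ler_peMr// ltW.
have Mz : M <= - z.
  have := mulr_ge0 (ltW K0) (addr_ge0 n0 ler01).
  by move: zZ; rewrite /Z; lra.
have z0 : z < 0 by rewrite -oppr_gt0.
have := hM z; rewrite (ltr0_norm z0) => /(_ Mz).
rewrite ler_norml => /andP[_ h4].
have cy : 0 < c * y by rewrite mulr_gt0.
move: h1 h2 h3 sy h4 cy; rewrite -/y.
rewrite (_ : z = - y); last by rewrite /y opprK.
by set A := L _ _ _; set B := L _ _ _; set D := g * _; lra.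
Qed.

Definition fluid_set (W : R -> R) x t := [set W z + L z x t | z in `]-oo, x]%classic].

(** Far exit points contribute at most 0 by [tail_le0]; the others are bounded by monotonicity of
    [V] and [L]. *)
Lemma has_sup_fluid x t : 0 < t -> has_sup (fluid_set V x t).
Proof.
move=> t0; split; first by exists (V x + L x x t), x => //=; rewrite in_itv/=.
have [K [Z [K0 Z0 h]]] := tail_le0.
pose m := Z + K * t + `|x|.
have Kt : 0 < K * t by rewrite mulr_gt0.
have n0 := normr_ge0 x; have xn := ler_norm x.
exists (Num.max 0 (V x + L (- m) x t)) => ? [z /=]; rewrite in_itv/= => zx <-.
rewrite le_max; have [zm|zm] := boolP (z <= - m).
  by rewrite h//; rewrite /m in zm; lra.
rewrite -ltNge in zm.
apply/orP; right; apply: lerD; first exact: V_mono.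
by apply: L_bound_mono => //; exact: ltW.
Qed.

Lemma fluidE W x t : Lfluid W C x t = sup (fluid_set W x t).
Proof. by []. Qed.

(* [c] is the slope at [u = b] of the concave function [g * sqrt u]. *)
Lemma concave_gap u : 0 <= u ->
  (g * Num.sqrt b - c * b) - (g * Num.sqrt u - c * u) = c * (Num.sqrt u - Num.sqrt b) ^+ 2.
Proof.
move=> u0; have sb : 0 < Num.sqrt b by rewrite sqrtr_gt0.
have ub := sqr_sqrtr u0; have bb := sqr_sqrtr (ltW b0).
move: ub bb cE; set su := Num.sqrt u; set s := Num.sqrt b => <- <- ->.
by field; rewrite gt_eqF.
Qed.

(* [W] is [V] with an atom of mass [e] added at the origin. The flux through
   [0, x] exceeds that of [V] by exactly [e] iff the fluid suprema at [x] agree,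
   i.e. iff some exit point [z1 >= 0] is at least as good as all those [z < 0]. *)
Lemma fluid_shift_eq (W : R -> R) x t e : 0 <= e -> 0 < t -> 0 <= x ->
  (forall z, W z = if z < 0 then V z - e else V z) ->
  (exists2 z1, 0 <= z1 <= x & forall z, z < 0 -> V z + L z x t <= V z1 + L z1 x t) ->
  Lfluid W C x t = Lfluid V C x t.
Proof.
move=> e0 t0 x0 WE [z1 /andP[z10 z1x] hz1].
have hs := has_sup_fluid x t0.
have WV z : W z <= V z by rewrite WE; case: ifP => _; lra.
have ubW y : fluid_set W x t y -> y <= sup (fluid_set V x t).
  move=> [z zx <-]; apply: (@le_trans _ _ (V z + L z x t)); first by rewrite lerD2r.
  by apply: sup_upper_bound => //; exists z.
have W0 : fluid_set W x t !=set0.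
  by exists (W x + L x x t), x => //=; rewrite in_itv/=.
rewrite !fluidE; apply/eqP; rewrite eq_le; apply/andP; split; first exact: ge_sup.
apply: ge_sup; first by case: hs.
have hub : has_ubound (fluid_set W x t) by exists (sup (fluid_set V x t)).
move=> _ [z /= zx <-]; have [z0|z0] := ltP z 0.
  apply: (le_trans (hz1 z z0)); apply: ub_le_sup => //; exists z1.
    by rewrite /= in_itv.
  by rewrite WE ltNge z10.
by apply: ub_le_sup => //; exists z => //; rewrite WE ltNge z0.
Qed.

(** Negative exit points lose the atom [e], the others are already worse by [e'], so the supremum
    drops by at least the smaller of the two. *)
Lemma fluid_shift_lt (W : R -> R) x t e : 0 < e -> 0 < t -> 0 <= x ->
  (forall z, W z = if z < 0 then V z - e else V z) ->
  (exists2 z0, z0 < 0 & exists2 e', 0 < e' &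
     forall z, 0 <= z <= x -> V z + L z x t <= V z0 + L z0 x t - e') ->
  Lfluid W C x t < Lfluid V C x t.
Proof.
move=> e0 t0 x0 WE [z0 z00 [e' e'0 h]].
have hs := has_sup_fluid x t0.
have up z : z <= x -> V z + L z x t <= sup (fluid_set V x t).
  by move=> zx; apply: sup_upper_bound => //; exists z => //=; rewrite in_itv.
pose m := Num.min e e'.
have m0 : 0 < m by rewrite lt_min e0.
have me : m <= e by rewrite ge_min lexx.
have me' : m <= e' by rewrite ge_min lexx orbT.
apply: (@le_lt_trans _ _ (sup (fluid_set V x t) - m)); last by rewrite fluidE ltrBlDr ltrDl.
apply: ge_sup; first by exists (W x + L x x t), x => //=; rewrite in_itv/=.
move=> _ [z /= zx <-]; rewrite in_itv/= in zx; rewrite WE.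
have [zneg|zpos] := ltP z 0.
  by have := up z zx; rewrite -/(L z x t); lra.
have := h z; rewrite zpos zx => /(_ isT).
have := up z0 (le_trans (ltW z00) x0); rewrite -/(L z x t); lra.
Qed.

Lemma fluid_shift_neg (W : R -> R) y t e : 0 < t -> y < 0 ->
  (forall z, W z = if z < 0 then V z - e else V z) ->
  Lfluid W C y t = Lfluid V C y t - e.
Proof.
move=> t0 y0 WE; have hs := has_sup_fluid y t0.
rewrite !fluidE; have -> : fluid_set W y t = [set v - e | v in fluid_set V y t].
  apply/seteqP; split => [_ [z zy <-]|_ [_ [z zy <-] <-]].
    exists (V z + L z y t); first by exists z.
    rewrite WE ifT; first by rewrite -/(L z y t); ring.
    by move: zy; rewrite /= in_itv/= => /le_lt_trans; exact.
  exists z => //; rewrite WE ifT; first by rewrite -/(L z y t); ring.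
  by move: zy; rewrite /= in_itv/= => /le_lt_trans; exact.
exact: sup_subr.
Qed.

Lemma fluid_mono x y t : 0 < t -> x <= y -> Lfluid V C x t <= Lfluid V C y t.
Proof.
move=> t0 xy; rewrite !fluidE; apply: ge_sup; first by case: (has_sup_fluid x t0).
move=> ? [z /=]; rewrite in_itv/= => zx <-.
apply: (@le_trans _ _ (V z + L z y t)); first by rewrite lerD2l; exact: L_bound_mono.
by apply: sup_upper_bound; [exact: has_sup_fluid|exists z => //=; rewrite in_itv/= (le_trans zx)].
Qed.

(** The infimum over [y < 0] is the value at [x] minus a supremum over [y < 0], and passing to [W]
    lowers that supremum by exactly [e]. *)
Lemma Mclosed_shift (W : R -> R) x t e : 0 < t -> 0 <= x ->
  (forall z, W z = if z < 0 then V z - e else V z) ->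
  (Mclosed W C t x = Mclosed V C t x + e) <-> (Lfluid W C x t = Lfluid V C x t).
Proof.
move=> t0 x0 WE.
have infE (a s : R) (f : R -> R) : (forall y, y < 0 -> f y <= s) ->
    inf [set a - f y | y in `]-oo, 0[%classic] = a - sup [set f y | y in `]-oo, 0[%classic].
  move=> hf.
  have hs : has_sup [set f y | y in `]-oo, 0[%classic].
    split; first by exists (f (-1)), (-1) => //=; rewrite in_itv/= oppr_lt0.
    by exists s => ? [y /=]; rewrite in_itv/= => y0 <-; exact: hf.
  apply/eqP; rewrite eq_le; apply/andP; split.
    rewrite -lerN2 opprB lerBlDr; apply: ge_sup; first by case: hs.
    move=> _ [y /= y0 <-]; rewrite -lerBlDr lerNr opprB addrC.
    have : inf [set a - f y | y in `]-oo, 0[%classic] <= a - f y.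
      apply: ge_inf; last by exists y.
      exists (a - s) => ? [y' /=]; rewrite in_itv/= => y'0 <-.
      by rewrite lerD2l lerN2; exact: hf.
    by lra.
  apply: lb_le_inf; first by exists (a - f (-1)), (-1) => //=; rewrite in_itv/= oppr_lt0.
  move=> _ [y /= y0 <-]; rewrite lerD2l lerN2; apply: sup_upper_bound => //.
  by exists y.
have hV y : y < 0 -> Lfluid V C y t <= Lfluid V C x t.
  by move=> y0; apply: fluid_mono => //; lra.
have hW y : y < 0 -> Lfluid W C y t <= Lfluid V C x t - e.
  by move=> y0; rewrite (fluid_shift_neg t0 y0 WE) lerD2r hV.
rewrite /Mclosed (infE _ _ _ hV) (infE _ _ _ hW).
have -> : sup [set Lfluid W C y t | y in `]-oo, 0[%classic] =
    sup [set Lfluid V C y t | y in `]-oo, 0[%classic] - e.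
  have -> : [set Lfluid W C y t | y in `]-oo, 0[%classic] =
     [set Lfluid V C y t - e | y in `]-oo, 0[%classic].
    by apply: eq_imagel => y /=; rewrite in_itv/= => y0; exact: fluid_shift_neg.
  rewrite -(image_comp (fun y => Lfluid V C y t) (fun v => v - e)).
  apply: sup_subr; split; first by exists (Lfluid V C (-1) t), (-1) => //=; rewrite in_itv/= oppr_lt0.
  by exists (Lfluid V C x t) => ? [y /=]; rewrite in_itv/= => y0 <-; exact: hV.
split; lra.
Qed.

(** * Rescaled exit points and the crossing position *)

Lemma sqrt_scale (u t : R) : 0 < t -> Num.sqrt (u * t * t) = t * Num.sqrt u.
Proof.
by move=> t0; rewrite -mulrA -expr2 mulrC sqrtrM ?sqr_ge0// sqrtr_sqr gtr0_norm.
Qed.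

(** Both approximations at once, in units of [t]: [z] is the exit point and [u] its distance to the
    observation point. *)
Lemma fluid_approx K e : 0 < K -> 0 < e -> exists T0, forall t, T0 <= t -> 0 < t ->
  forall z u, - K <= z -> 0 <= u -> z + u <= K ->
  `|V (z * t) + L (z * t) ((z + u) * t) t - t * (c * z + g * Num.sqrt u)| <= e * t.
Proof.
move=> K0 e0; have e20 : 0 < e / 2 by rewrite divr_gt0.
have [T1 h1] := uniform K0 e20; have [T2 h2] := V_linear K0 e20.
exists (Num.max T1 T2) => t; rewrite ge_max => /andP[t1 t2] t0 z u Kz u0 zuK.
have ut0 : 0 <= u * t by rewrite mulr_ge0// ltW.
have b1 : - (K * t) <= z * t by rewrite -mulNr ler_pM2r.
have b2 : z * t <= (z + u) * t by rewrite mulrDl lerDl.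
have b3 : (z + u) * t <= K * t by rewrite ler_pM2r.
have := h1 t t1 t0 _ _ b1 b2 b3.
have -> : (z + u) * t - z * t = u * t by ring.
rewrite sqrt_scale//.
have := h2 t t2 t0 _ b1 (le_trans b2 b3).
rewrite !ler_norml => /andP[v1 v2] /andP[w1 w2].
apply/andP; split; lra.
Qed.

(** At [x = (b + dl) * t] the limiting maximiser [dl * t] is positive, while negative exit points
    are at distance at least [(b + dl) * t], where [concave_gap] is bounded below. *)
Lemma crossing_above (dl : R) : 0 < dl -> exists T0, forall t, T0 <= t -> 0 < t ->
  exists2 z1, 0 <= z1 <= (b + dl) * t &
    forall z, z < 0 -> V z + L z ((b + dl) * t) t <= V z1 + L z1 ((b + dl) * t) t.
Proof.
move=> d0; have c0 := slope_gt0; have bp := b0.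
have sb : 0 < Num.sqrt b by rewrite sqrtr_gt0.
pose kp := Num.sqrt (b + dl) - Num.sqrt b.
have kp0 : 0 < kp by rewrite subr_gt0 ltr_sqrt ?ltrDl// addr_gt0.
(* The first bound fits the two approximation errors into the gap; the second keeps the value at
   [dl * t] nonnegative, hence above the far exit points. *)
have [e e0 [e1 e2]] : exists2 e, 0 < e & 2 * e <= c * kp ^+ 2 /\ e <= g * Num.sqrt b.
  exists (Num.min (c * kp ^+ 2 / 2) (g * Num.sqrt b)).
    by rewrite lt_min divr_gt0 ?mulr_gt0// exprn_gt0.
  split; last by rewrite ge_min lexx orbT.
  by rewrite -ler_pdivlMl// mulrC ge_min lexx.
have [K1 [Z [K10 Z0 hZ]]] := tail_le0.
pose K := K1 + b + dl.
have K0 : 0 < K by rewrite /K; lra.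
have [T1 hT] := fluid_approx K0 e0.
exists (Num.max T1 (Z / K)) => t; rewrite ge_max => /andP[t1 t2] t0.
have tK : Z <= K * t by rewrite mulrC -ler_pdivrMr.
exists (dl * t).
  by rewrite mulr_ge0 ?(ltW t0) ?(ltW d0)//= ler_pM2r// lerDr ltW.
have : `|V (dl * t) + L (dl * t) ((dl + b) * t) t - t * (c * dl + g * Num.sqrt b)| <= e * t.
  by apply: hT => //; rewrite /K; lra.
rewrite [dl + b]addrC ler_norml => /andP[r1 _] z z0.
have r2 : t * (c * dl + g * Num.sqrt b) - e * t <= V (dl * t) + L (dl * t) ((b + dl) * t) t.
  by lra.
apply: le_trans r2; have [zK|zK] := boolP (z <= - (K * t)).
  have K1t : 0 <= K1 * t by rewrite mulr_ge0// ltW.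
  have bt : 0 <= (b + dl) * t by rewrite mulr_ge0 ?(ltW t0)//; lra.
  have KE : K * t = K1 * t + (b + dl) * t by rewrite /K; ring.
  apply: (@le_trans _ _ 0); first by apply: hZ => //; lra.
  have h3 : e * t <= g * Num.sqrt b * t by rewrite ler_pM2r.
  have h4 : 0 <= t * (c * dl) by rewrite !mulr_ge0// ltW.
  lra.
rewrite -ltNge in zK.
pose y := z / t; have zE : z = y * t by rewrite /y divfK// gt_eqF.
have y0 : y < 0 by rewrite /y pmulr_llt0// invr_gt0.
have yK : - K <= y by rewrite /y ler_pdivlMr// mulNr ltW.
pose u := b + dl - y.
have ub : b + dl <= u by rewrite /u; lra.
have u0 : 0 <= u by lra.
have : `|V (y * t) + L (y * t) ((y + u) * t) t - t * (c * y + g * Num.sqrt u)| <= e * t.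
  by apply: hT => //; rewrite /u /K; lra.
have -> : y + u = b + dl by rewrite /u; ring.
rewrite zE ler_norml => /andP[_ r3].
have gap := concave_gap u0.
have su : Num.sqrt (b + dl) <= Num.sqrt u by exact: ler_wsqrtr.
have kpu : kp ^+ 2 <= (Num.sqrt u - Num.sqrt b) ^+ 2.
  by rewrite lerXn2r ?nnegrE ?(ltW kp0)// ?lerD2r// subr_ge0; apply: le_trans su; apply: ler_wsqrtr; lra.
have ckp : c * kp ^+ 2 <= c * (Num.sqrt u - Num.sqrt b) ^+ 2 by rewrite ler_pM2l.
have cy : c * y = c * b + c * dl - c * u by rewrite /u; ring.
have fin : c * y + g * Num.sqrt u + 2 * e <= c * dl + g * Num.sqrt b by lra.
have : t * (c * y + g * Num.sqrt u + 2 * e) <= t * (c * dl + g * Num.sqrt b) by rewrite ler_pM2l.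
lra.
Qed.

(** The maximiser [x - b * t] is now negative, while exit points in [[0, x]] are at distance at most
    [(b - dl) * t]. *)
Lemma crossing_below (dl : R) : 0 < dl -> exists T0, forall t, T0 <= t -> 0 < t ->
  forall x, 0 <= x <= (b - dl) * t ->
  exists2 z0, z0 < 0 & exists2 e', 0 < e' &
    forall z, 0 <= z <= x -> V z + L z x t <= V z0 + L z0 x t - e'.
Proof.
move=> d0; have c0 := slope_gt0; have bp := b0.
have sb : 0 < Num.sqrt b by rewrite sqrtr_gt0.
(* For [dl > b] the root of the negative number is 0 and the range of [x] is empty. *)
pose kp := Num.sqrt b - Num.sqrt (b - dl).
have kp0 : 0 < kp by rewrite subr_gt0 ltr_sqrt// gtrBl.
(* The gap is [4 * e]: two approximation errors leave the strict margin [2 * e * t]. *)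
pose e := c * kp ^+ 2 / 4.
have e0 : 0 < e by rewrite divr_gt0// mulr_gt0// exprn_gt0.
have [T1 hT] := fluid_approx b0 e0.
exists T1 => t t1 t0 x /andP[x0 xb].
pose y := x / t; have xE : x = y * t by rewrite /y divfK// gt_eqF.
have y0 : 0 <= y by rewrite /y divr_ge0// ltW.
have yb : y <= b - dl by rewrite /y ler_pdivrMr.
exists ((y - b) * t); first by rewrite nmulr_rlt0//; lra.
exists (2 * (e * t)); first by rewrite !mulr_gt0.
have : `|V ((y - b) * t) + L ((y - b) * t) ((y - b + b) * t) t - t * (c * (y - b) + g * Num.sqrt b)| <= e * t.
  by apply: hT => //; lra.
rewrite subrK -xE ler_norml => /andP[r1 _] z /andP[z0 zx].
pose v := z / t; have zE : z = v * t by rewrite /v divfK// gt_eqF.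
have v0 : 0 <= v by rewrite /v divr_ge0// ltW.
have vy : v <= y by rewrite /v /y ler_pM2r// invr_gt0.
pose u := y - v.
have u0 : 0 <= u by rewrite subr_ge0.
have : `|V (v * t) + L (v * t) ((v + u) * t) t - t * (c * v + g * Num.sqrt u)| <= e * t.
  by apply: hT => //; rewrite /u; lra.
have -> : v + u = y by rewrite /u; ring.
rewrite -zE -xE ler_norml => /andP[_ r3].
have gap := concave_gap u0.
have su : Num.sqrt u <= Num.sqrt (b - dl) by apply: ler_wsqrtr; rewrite /u; lra.
have kpu : kp ^+ 2 <= (Num.sqrt u - Num.sqrt b) ^+ 2.
  rewrite -[(Num.sqrt u - _) ^+ 2]sqrrN opprB.
  by rewrite lerXn2r ?nnegrE ?(ltW kp0)// ?lerD2l ?lerN2// subr_ge0; apply: (le_trans su); apply: ler_wsqrtr; lra.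
have ckp : c * kp ^+ 2 <= c * (Num.sqrt u - Num.sqrt b) ^+ 2 by rewrite ler_pM2l.
have cv : c * v = c * y - c * u by rewrite /u; ring.
have e4 : c * kp ^+ 2 = 4 * e by rewrite /e; field.
have fin : c * v + g * Num.sqrt u + 4 * e <= c * (y - b) + g * Num.sqrt b by lra.
have : t * (c * v + g * Num.sqrt u + 4 * e) <= t * (c * (y - b) + g * Num.sqrt b) by rewrite ler_pM2l.
lra.
Qed.

Lemma crossing_cvg (W : R -> R) e : 0 < e ->
  (forall z, W z = if z < 0 then V z - e else V z) ->
  inf [set x | 0 <= x /\ Mclosed W C t x = Mclosed V C t x + e] / t @[t --> +oo] --> b.
Proof.
move=> e0 WE; apply/cvgrPdist_le => dl d0; have bp := b0.
have [T1 h1] := crossing_above d0; have [T2 h2] := crossing_below d0.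
exists (Num.max 0 (Num.max T1 T2)); split; first exact: num_real.
move=> t; rewrite !gt_max => /andP[t0 /andP[t1 t2]].
set S := [set x | _ /\ _].
have Sx : S ((b + dl) * t).
  have x0 : 0 <= (b + dl) * t by rewrite mulr_ge0 ?(ltW t0)//; lra.
  split => //; apply/(Mclosed_shift t0 x0 WE).
  by apply: (fluid_shift_eq (ltW e0) t0 x0 WE); apply: h1 => //; exact: ltW.
have lb x : S x -> (b - dl) * t <= x.
  move=> [x0 /(Mclosed_shift t0 x0 WE) E]; rewrite leNgt; apply/negP => xb.
  suff : Lfluid W C x t < Lfluid V C x t by rewrite E ltxx.
  apply: (fluid_shift_lt e0 t0 x0 WE); apply: h2 => //; first exact: ltW.
  by rewrite x0 ltW.
have i1 : inf S <= (b + dl) * t.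
  by apply: ge_inf => //; exists ((b - dl) * t).
have i2 : (b - dl) * t <= inf S by apply: lb_le_inf => //; exists ((b + dl) * t).
have j1 : inf S / t <= b + dl by rewrite ler_pdivrMr.
have j2 : b - dl <= inf S / t by rewrite ler_pdivlMr.
by rewrite ler_norml; apply/andP; split; lra.
Qed.

End Fluid.

(** * Distribution functions and conclusion *)

Lemma tan_gt0_third_quadrant (R : realType) (al : R) : pi < al < 3 * pi / 2 -> 0 < tan al.
Proof.
move=> /andP[a1 a2]; have p0 := pi_gt0 R.
have -> : al = (al - pi) + pi by rewrite subrK.
rewrite /tan sinDpi cosDpi invrN mulrNN divr_gt0//.
  by apply: sin_gt0_pi; apply/andP; split; lra.
by apply: cos_gt0_pihalf; apply/andP; split; lra.
Qed.

Section DistFn.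
Context (R : realType) (nu : {measure set R -> \bar R}).
Hypothesis nu_lf : locally_finite nu.

Let fin (x y : R) : nu `]x, y]%classic \is a fin_num.
Proof. by rewrite ge0_fin_numE// nu_lf. Qed.

Lemma dist_fn_mono : {homo dist_fn nu : x y / x <= y}.
Proof.
have mono (x y x' y' : R) : x' <= x -> y <= y' ->
    fine (nu `]x, y]%classic) <= fine (nu `]x', y']%classic).
  move=> xx yy; apply: fine_le; rewrite ?fin//.
  apply: le_measure; rewrite ?inE//.
  move=> z /=; rewrite !in_itv/= => /andP[h1 h2].
  by rewrite (le_lt_trans xx h1) (le_trans h2 yy).
move=> x y xy; rewrite /dist_fn; have [x0|x0] := leP 0 x.
  by rewrite (le_trans x0 xy) mono.
have [y0|y0] := leP 0 y.
  by apply: (@le_trans _ _ 0); [rewrite oppr_le0 fine_ge0|rewrite fine_ge0].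
by rewrite lerN2 mono.
Qed.

(** The origin belongs to []z, 0]] but not to []0, z]], so the atom appears as a drop by [eps] on
    the left. *)
Lemma dist_fn_add_atom0 eps z : dist_fn (add_atom0 nu eps) z =
  if z < 0 then dist_fn nu z - eps else dist_fn nu z.
Proof.
rewrite /dist_fn /add_atom0; have [z0|z0] := leP 0 z.
  by rewrite diracE memNset ?mule0 ?adde0//= in_itv/= ltxx.
rewrite diracE mem_set ?mule1; last by rewrite /= in_itv/= z0 lexx.
by rewrite fineD//= opprD.
Qed.

End DistFn.

Lemma ae_forall_countable (R : realType) (d : measure_display) (Omega : measurableType d)
  (P : probability Omega R) (T : countType) (Q : T -> Omega -> Prop) :
  (forall x, {ae P, forall w, Q x w}) -> {ae P, forall w, forall x, Q x w}.
Proof.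
move=> h; pose Q' n w := if unpickle n is Some x then Q x w else True.
have : {ae P, forall w, forall n, Q' n w}.
  apply/ae_foralln => n; rewrite /Q'; case: (unpickle n) => [x|]; first exact: h.
  exact: aeW.
by apply: filterS => w hw x; have := hw (pickle x); rewrite /Q' pickleK.
Qed.

Theorem theorem4p3 (R : realType) (d : measure_display) (Omega : measurableType d)
    (P : probability Omega R) (F : probability R R) (Pi : Omega -> set (Pt R))
    (nu : {measure set R -> \bar R}) (alpha eps : R) :
  F `]-oo, 0]%classic = 0%E ->
  (exists a : R, 0 < a /\ (\int[F]_x (expR (a * x))%:E < +oo)%E) ->
  is_poisson_process P Pi (intensity F) ->
  pi < alpha < 3 * pi / 2 ->
  locally_finite nu ->
  (dist_fn nu x / x @[x --> +oo] --> fine (gammaF P Pi) / 2 * Num.sqrt (tan alpha)) ->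
  (dist_fn nu x / x @[x --> -oo] --> fine (gammaF P Pi) / 2 * Num.sqrt (tan alpha)) ->
  0 < eps ->
  {ae P, forall w, Xsecond nu eps (Pi w) t / t @[t --> +oo] --> (tan alpha)^-1}.
Proof.
move=> F0 [a [a0 ea]] /poisson_miss_law hmiss /tan_gt0_third_quadrant ta nu_lf.
have [g g0 [gE hg]] := time_constant hmiss a0 ea F0; rewrite gE /= => vp vn e0.
(* Countably many squares exhaust the plane: off one null set, chain sums are bounded in every
   box. *)
have abdd : {ae P, forall w, forall N : nat,
    lpp_bounded Pi (- N.+1%:R, - N.+1%:R) (N.+1%:R, N.+1%:R) w}.
  apply/ae_foralln => N; apply: (ae_lpp_bounded hmiss a0 ea).
  by rewrite /below /= !gtrN.
have alim : {ae P, forall w, forall x : (nat * int * int * nat)%type,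
    x.1.1.2 < x.1.2 -> (0 < x.2)%N ->
    LPP (Pi w) (scale_pt (2 ^+ k) (grid_corner R x.1.1.1 x.1.1.2 0))
      (scale_pt (2 ^+ k) (grid_corner R x.1.1.1 x.1.2 x.2)) / 2 ^+ k @[k --> \oo]
    --> g * Num.sqrt ((x.1.2 - x.1.1.2)%:~R / x.1.1.1.+1%:R * (x.2%:R / x.1.1.1.+1%:R))}.
  apply: ae_forall_countable => -[[[N m] n] e] /=.
  have [mn|mn] := boolP (m < n); last by apply: aeW.
  have [e1|e1] := boolP (0 < e)%N; last by apply: aeW.
  have N0 : 0 < N.+1%:R :> R by rewrite ltr0n.
  have bl : below (grid_corner R N m 0) (grid_corner R N n e).
    by rewrite /below /= !ltr_pM2r ?invr_gt0// ltr_int mn ltr_nat.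
  have -> : (n - m)%:~R / N.+1%:R * (e%:R / N.+1%:R) =
      area (grid_corner R N m 0) (grid_corner R N n e).
    by rewrite /area /= mul0r subr0 -mulrBl intrB.
  by apply: filterS (hg _ _ bl).
(* From here on the configuration is fixed and the argument is deterministic. *)
apply: filterS2 abdd alim => w bdd lim.
have bdd' p q : has_ubound (chain_sums (Pi w) p q).
  pose N := Num.truncn (`|p.1| + `|p.2| + `|q.1| + `|q.2|).
  have hN : `|p.1| + `|p.2| + `|q.1| + `|q.2| < N.+1%:R by exact: truncnS_gt.
  have := normr_ge0 p.1; have := normr_ge0 p.2.
  have := normr_ge0 q.1; have := normr_ge0 q.2.
  have := ler_norm (- p.1); have := ler_norm (- p.2).
  have := ler_norm q.1; have := ler_norm q.2; rewrite !normrN => *.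
  by apply: has_ubound_sub (bdd N) => /=; lra.
have tb : 0 < (tan alpha)^-1 by rewrite invr_gt0.
(* Identifies the given slope with the derivative of [g * sqrt u] at [u = 1 / tan alpha]. *)
have cE : g / 2 * Num.sqrt (tan alpha) = g / (2 * Num.sqrt (tan alpha)^-1).
  by rewrite sqrtrV ?ltW// invfM invrK mulrA.
apply: (crossing_cvg g0 tb cE bdd' _ (dist_fn_mono nu_lf) vp vn e0 (dist_fn_add_atom0 nu_lf eps)).
by apply: (uniform_limit g0 bdd') => N m n e mn e1; exact: (lim (N, m, n, e)).
Qed.
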